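(* Every integrally closed subring of $\overline{\mathbb{Z}}$ has a universal grading whose grading group is (isomorphic to) a subgroup of $\mathbb{Q}/\mathbb{Z}$.
   Context: $\overline{\mathbb{Z}}$ is the ring of algebraic integers in an algebraic closure $\overline{\mathbb{Q}}$ of $\mathbb{Q}$. A subring is integrally closed if it is integrally closed in its field of fractions. A grading of a ring $R$ is a pair $(G,\{R_g\}_{g\in G})$ such that $G$ is an abelian group (written multiplicatively), called the grading group, $R_g$ is an additive subgroup of $R$ for all $g\in G$, the natural map $\bigoplus_{g\in G}R_g\to R$ is an isomorphism of groups, and $R_gR_{g'}\subseteq R_{gg'}$ for all $g,g'\in G$. A grading $(G,\{R_g\}_g)$ of $R$ is universal if for each grading $(H,\{S_h\}_h)$ of $R$ there exists a unique group homomorphism $f:G\to H$ such that $S_h=\sum_{g\in f^{-1}(h)}R_g$ for all $h\in H$. *)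

(* Defs.v *)
From HB Require Import structures.
From mathcomp Require Import all_boot all_order all_algebra all_field.
From mathcomp Require Import ring_quotient fraction.
From mathcomp Require Import finmap.
From mathcomp Require Import boolp classical_sets functions.

Set Implicit Arguments.
Unset Strict Implicit.
Unset Printing Implicit Defensive.

Import GRing.Theory Num.Theory.

Local Open Scope classical_set_scope.
Local Open Scope ring_scope.

(* The subring of a field K carved out by a closed predicate S, as a type of
   its own. Under classical axioms, boolean predicates on K are the same thing
   as arbitrary subsets of K, so S is an arbitrary (unital) subring. *)
Section SubringType.
Variables (K : fieldType) (S : subringClosed K).

Record subring : Type :=
  Subring { subring_val : K; subring_valP : subring_val \in S }.

HB.instance Definition _ := [isSub for subring_val].
HB.instance Definition _ := [Choice of subring by <:].
HB.instance Definition _ := [SubChoice_isSubComNzRing of subring by <:].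

Definition subring_unit : {pred subring} :=
  fun x => (val x != 0) && ((val x)^-1 \in S).

Definition subring_inv (x : subring) : subring := insubd x (val x)^-1.

Fact subring_mulVx : {in subring_unit, left_inverse 1 subring_inv *%R}.
Proof.
move=> x /andP[x0 xS]; apply: val_inj.
by rewrite rmorphM rmorph1 /= /subring_inv insubdK // mulVf.
Qed.

Fact subring_unitPl (x y : subring) : y * x = 1 -> x \in subring_unit.
Proof.
move=> /(congr1 val); rewrite rmorphM rmorph1 /= => yx1.
have x0 : val x != 0.
  by apply: contra_eq_neq yx1 => ->; rewrite mulr0 eq_sym oner_neq0.
have Dy : (val x)^-1 = val y by apply: (mulIf x0); rewrite mulVf.
by rewrite unfold_in /subring_unit x0 Dy (valP y).
Qed.

Fact subring_inv_out : {in [predC subring_unit], subring_inv =1 id}.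
Proof.
move=> x; rewrite inE /= unfold_in /subring_unit negb_and negbK => nUx.
apply: val_inj; rewrite /subring_inv val_insubd.
case/orP: nUx => [/eqP -> | /negPf -> //].
by rewrite invr0 if_same.
Qed.

HB.instance Definition _ := GRing.ComNzRing_hasMulInverse.Build subring
  subring_mulVx subring_unitPl subring_inv_out.

Fact subring_integral (x y : subring) : x * y = 0 -> (x == 0) || (y == 0).
Proof.
move=> /(congr1 val)/eqP; rewrite rmorphM rmorph0 mulf_eq0.
by rewrite -(rmorph0 (val : subring -> K)) !(inj_eq val_inj).
Qed.

HB.instance Definition _ := GRing.ComUnitRing_isIntegral.Build subring
  subring_integral.

End SubringType.

Definition integrally_closed (R : idomainType) : Prop :=
  forall x : {fraction R},
    integralOver (@FracField.tofrac R) x -> exists r : R, x = FracField.tofrac r.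

Definition additive_subgroup (A : zmodType) (B : set A) : Prop :=
  B 0 /\ forall x y : A, B x -> B y -> B (x - y).

(* Gradings. The grading group, written multiplicatively in the literature, is
   here a zmodType, hence additive: R_g R_g' is contained in R_(g + g'). *)
Section Gradings.
Variable R : pzRingType.

(* The direct sum of the R_g, realized as the finitely supported families. *)
Definition direct_sum (G : zmodType) (P : G -> set R) :
    set {fsfun G -> R with 0} :=
  [set x | forall g, P g (x g)].

Definition family_sum (G : zmodType) (x : {fsfun G -> R with 0}) : R :=
  \sum_(g <- finsupp x) x g.

Definition is_grading (G : zmodType) (P : G -> set R) : Prop :=
  [/\ forall g, additive_subgroup (P g),
      set_bij (direct_sum P) [set: R] (@family_sum G) &
      forall g g' x y, P g x -> P g' y -> P (g + g') (x * y)].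

(* The sum, for g in A, of the subgroups R_g. *)
Definition sum_over (G : zmodType) (P : G -> set R) (A : set G) : set R :=
  [set family_sum x | x in [set x | direct_sum P x /\
                                    forall g, g \in finsupp x -> A g]].

Definition regrades (G H : zmodType) (P : G -> set R) (Q : H -> set R)
    (f : G -> H) : Prop :=
  forall h, Q h = sum_over P (f @^-1` [set h]).

Definition is_universal_grading (G : zmodType) (P : G -> set R) : Prop :=
  is_grading P /\
  forall (H : zmodType) (Q : H -> set R), is_grading Q ->
    exists f : {additive G -> H}, regrades P Q f /\
      forall f' : {additive G -> H}, regrades P Q f' -> f' =1 f.

End Gradings.

(* Num.int_num_subdef is the predicate underlying the qualifier Num.int. *)
Definition QmodZ : zmodType :=
  @Quotient.quot rat (GRing.ZmodClosed.clone rat (@Num.int_num_subdef rat) _).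

Definition isomorphic_to_subgroup (G A : zmodType) : Prop :=
  exists2 B : set A, additive_subgroup B &
    exists f : {additive G -> A}, set_bij [set: G] B f.

(* Main.v *)
Require Import Defs.
From HB Require Import structures.
From mathcomp Require Import all_boot all_order all_fingroup all_algebra all_field.
From mathcomp Require Import generic_quotient ring_quotient fraction finmap ring.
From mathcomp Require Import boolp classical_sets functions.

(** Let R be the ring and let q(x) be the mean of |x'|^2 over the conjugates x'
    of x. This is a positive definite quadratic form, and q(x) >= 1 for a nonzero
    algebraic integer x, by the inequality between arithmetic and geometric means
    applied to the norm of x. For a grading of R, the components R_g are pairwise
    orthogonal for q ([graded_orthogonal]): if y and z have different degrees,
    then y / z has trace zero over the degree-zero part of the fraction field,
    because the minimal polynomial of a homogeneous element lacks its second
    coefficient. Hence taking components splits q additively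
    ([mean_square_component]), and an element can only be cut finitely often into
    components of gradings. So every element of R is a sum of elements that are
    homogeneous for all gradings at once ([universally_homogeneous_sum]).

    Call two nonzero elements of this kind equivalent when they have the same
    degree in every grading. The equivalence classes form a group under
    multiplication: a nonzero x satisfies an integral equation with nonzero
    constant term, which forces some power of x, with an exponent bounded in terms
    of x alone, to have degree zero ([degree_torsion]). This group grades R, and
    every grading is a coarsening of that one ([universal_family_universal]).

    Integral closedness gives that the grading group is a subgroup of Q/Z. A
    torsion group embeds into Q/Z as soon as its p-torsion is cyclic for all primes
    p ([embedding_QmodZ]). Suppose that x and y are homogeneous of degrees g and h
    that are killed by p, with g nonzero and h not a multiple of g. Let E be the
    intersection of R with the number field Q(x, y), let E_0 be its degree-zero
    part, and let M be a prime ideal containing p. Integral closedness makes the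
    local rings of E and E_0 at M discrete valuation rings; let t and u be
    uniformizers. Modulo p, the p-th power of a sum is the sum of the p-th powers
    of the components, so z^p lies in E_0 + pE for all z in E. As finite fields
    are perfect, E and E_0 then have the same residue field, and t^p is in uE
    locally; so the p elements 1, t, ..., t^(p-1) span E / uE over E_0 locally
    ([local_span]). On the other hand, the p + 1 elements 1, x, ..., x^(p-1), y
    have different degrees, and after removing powers of u they are linearly
    independent modulo u. This is a contradiction ([rank_one_core]). *)

Set Implicit Arguments.
Unset Strict Implicit.
Unset Printing Implicit Defensive.

Import Order.TTheory GRing.Theory Num.Theory.

Local Open Scope ring_scope.

(** * The mean square of the conjugates of an algebraic number *)

Section GaloisOrbits.

Variables (F : fieldType) (L : splittingFieldType F) (K E : {subfield L}).
Hypothesis galKE : galois K E.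

(** The Galois group acts transitively on the roots of a minimal polynomial, with
    fibres the cosets of a stabilizer; c is the order of that stabilizer. *)
Lemma galois_orbit_sum a : a \in E ->
  exists (c : nat) (rs : seq L),
    [/\ (0 < c)%N, minPoly K a = \prod_(r <- rs) ('X - r%:P) &
        forall (V : zmodType) (f : L -> V),
          \sum_(s in 'Gal(E / K)%g) f (s a) = (\sum_(r <- rs) f r) *+ c].
Proof.
move=> Ea; have /and3P[sKE _ _] := galKE.
have /(galois_factors sKE)/(_ a Ea)[gs [/fintype.subsetP sgs Ugs minE]] := galKE.
pose stab := [set s in 'Gal(E / K)%g | s a == a].
exists #|stab|, [seq s a | s : gal_of E <- gs]; split=> //.
  by apply/card_gt0P; exists 1%g; rewrite inE group1 gal_id eqxx.
move=> V f; set rs := [seq s a | s : gal_of E <- gs] in Ugs minE *.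
have mem_rs s : s \in 'Gal(E / K)%g -> s a \in rs.
  by move=> Gs; rewrite -root_prod_XsubC -minE root_minPoly_gal.
transitivity (\sum_(s in 'Gal(E / K)%g) \sum_(r <- rs) (if s a == r then f r else 0)).
  apply: eq_bigr => s /mem_rs rs_s; rewrite (bigD1_seq (s a)) //= eqxx big1 ?addr0 //.
  by move=> r; rewrite eq_sym => /negPf->.
rewrite exchange_big -sumrMnl big_seq [RHS]big_seq.
apply: eq_bigr => _ /mapP[s0 /sgs Gs0 ->].
rewrite -big_mkcondr /= sumr_const; congr (_ *+ _).
rewrite -(card_rcoset stab s0); apply: eq_card => s; rewrite mem_rcoset !inE.
rewrite groupMr ?groupV //; apply: andb_id2l => Gs.
have s0VK : (s0^-1)%g (s0 a) = a by rewrite -galM // mulgV gal_id.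
by rewrite galM // -{4}s0VK (inj_eq (fmorph_inj _)).
Qed.

End GaloisOrbits.

Definition conjugates (x : algC) : seq algC :=
  sval (closed_field_poly_normal (minCpoly x)).

Lemma minCpoly_conjugates x : minCpoly x = \prod_(r <- conjugates x) ('X - r%:P).
Proof.
rewrite /conjugates; case: (closed_field_poly_normal _) => rs /= {1}->.
by rewrite (monicP (minCpoly_monic x)) scale1r.
Qed.

Lemma size_conjugates_gt0 x : (0 < size (conjugates x))%N.
Proof.
by have := size_minCpoly x; rewrite minCpoly_conjugates size_prod_XsubC ltnS.
Qed.

(** Dividing by the degree makes this the mean over the embeddings of any number
    field that contains x, so it does not depend on such a field. *)
Definition mean_square (x : algC) : algC :=
  (\sum_(r <- conjugates x) `|r| ^+ 2) / (size (conjugates x))%:R.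

Lemma mean_square_ge0 x : 0 <= mean_square x.
Proof.
by rewrite divr_ge0 ?ler0n ?sumr_ge0 // => r _; rewrite exprn_ge0.
Qed.

Lemma minCpoly_coef0 x : x != 0 -> (minCpoly x)`_0 != 0.
Proof.
move=> x0; apply/eqP => p0; have [p [Dp mon_p] dvd_p] := minCpolyP x.
have: root p 0.
  by apply/rootP; rewrite horner_coef0; apply: (fmorph_inj (@ratr algC));
     rewrite -coef_map -Dp p0 rmorph0.
case/factor_theorem => q; rewrite subr0 => Dpq.
have q0 : q != 0.
  by apply/eqP => q0; have := monic_neq0 mon_p; rewrite Dpq q0 mul0r eqxx.
have: root (map_poly ratr p) x by rewrite dvd_p.
rewrite {1}Dpq rmorphM /= map_polyX rootM rootX (negPf x0) orbF dvd_p.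
by move/(dvdp_leq q0); rewrite Dpq size_mulX // ltnn.
Qed.

(** The product of the conjugates is a nonzero integer, so their geometric mean
    is at least 1 in absolute value. *)
Lemma mean_square_ge1 x : x \in Aint -> x != 0 -> 1 <= mean_square x.
Proof.
move=> Ax x0; set n := size (conjugates x).
have n_gt0 : (0 < n)%N := size_conjugates_gt0 x.
have prod_ge1 : 1 <= \prod_(r <- conjugates x) `|r|.
  have: (minCpoly x)`_0 \in Num.int by move: Ax; rewrite unfold_in => /polyOverP.
  move/norm_intr_ge1 => /(_ (minCpoly_coef0 x0)).
  rewrite minCpoly_conjugates -horner_coef0 horner_prod normr_prod.
  by under eq_bigr do rewrite hornerXsubC sub0r normrN.
have nR0 : 0 < n%:R :> algC by rewrite ltr0n.
have ms_real : mean_square x \is Num.real by rewrite ger0_real ?mean_square_ge0.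
rewrite real_leNgt ?real1 //; apply/negP => ms_lt1.
pose I : finType := 'I_n; pose e (i : I) := `|(conjugates x)`_i| ^+ 2 / n%:R.
have e_ge0 : {in predT, forall i : I, 0 <= e i *+ #|{: I}|}.
  by move=> i _; rewrite mulrn_wge0 // divr_ge0 ?ler0n ?exprn_ge0.
have [le_AGM _] := leif_AGM_scaled e_ge0; move: le_AGM.
rewrite card_ord.
have -> : \sum_(i in predT) e i = mean_square x.
  by rewrite -mulr_suml /mean_square (big_nth 0) big_mkord.
have -> : \prod_(i in predT) (e i *+ n) = (\prod_(r <- conjugates x) `|r|) ^+ 2.
  rewrite (big_nth 0) big_mkord -prodrXl; apply: eq_bigr => i _.
  by rewrite /e -mulr_natr divfK ?gt_eqF.
move/(le_trans (exprn_ege1 2 prod_ge1)); rewrite real_leNgt ?rpredX ?real1 //.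
by rewrite exprn_ilt1 ?mean_square_ge0 // -lt0n n_gt0.
Qed.

Lemma galois_rat (L : splittingFieldType rat) (K : {subfield L}) : galois K {:L}.
Proof.
apply/and3P; split; [exact: subvf | | exact: normalFieldf].
by apply/separableP => x _; apply: pcharf0_separable => p; rewrite pchar_lalg pchar_num.
Qed.

(** A normal number field containing s is generated by all the conjugates of the
    elements of s. *)
Lemma normal_number_field (s : seq algC) :
  exists (L : splittingFieldType rat) (iota : {rmorphism L -> algC}),
    forall x, x \in s -> exists y, x = iota y.
Proof.
have [Qs [QsC [s1 Ds1 genQs]]] := num_field_exists (flatten [seq conjugates x | x <- s]).
have splitQs : splitting_field_axiom Qs.
  pose ratpoly x := sval (minCpolyP x).
  exists (\prod_(x <- s) map_poly (in_alg Qs) (ratpoly x)).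
    apply: rpred_prod => x _; apply/polyOverP => i.
    by rewrite coef_map memvZ ?memv_line.
  exists s1 => //; rewrite (_ : \prod_(x <- s) _ = \prod_(z <- s1) ('X - z%:P)) ?eqpxx //.
  apply/(map_poly_inj QsC); rewrite !rmorph_prod.
  transitivity (\prod_(z <- map QsC s1) ('X - z%:P)); last first.
    by rewrite big_map; apply: eq_bigr => z _; rewrite /= map_polyXsubC.
  rewrite Ds1 big_flatten big_map; apply: eq_bigr => x _.
  rewrite -minCpoly_conjugates /ratpoly; case: (minCpolyP x) => p /= [-> _] _.
  rewrite -map_poly_comp; apply: eq_map_poly => b /=.
  by rewrite alg_num_field fmorph_rat.
pose L : splittingFieldType rat :=
  HB.pack Qs (FieldExt_isSplittingField.Build rat Qs splitQs).
exists L, QsC => x sx.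
have : x \in map QsC s1.
  rewrite Ds1; apply/flatten_mapP; exists x => //.
  by rewrite -root_prod_XsubC -minCpoly_conjugates root_minCpoly.
by case/mapP => y _ ->; exists y.
Qed.

Section NormalField.

Variables (L : splittingFieldType rat) (iota : {rmorphism L -> algC}).

Lemma minCpoly_normal_field x : minCpoly (iota x) = map_poly iota (minPoly 1 x).
Proof.
have alg_iota p : map_poly iota (map_poly (in_alg L) p) = map_poly ratr p.
  rewrite -map_poly_comp; apply: eq_map_poly => b /=.
  by rewrite alg_num_field fmorph_rat.
have [q Dq] : exists q, map_poly (in_alg L) q = minPoly 1 x.
  have aP i : (minPoly 1 x)`_i \in 1%VS by apply/polyOverP; apply: minPolyOver.
  have a_ i := sig_eqW (vlineP _ _ (aP i)).
  exists (\poly_(i < size (minPoly 1 x)) sval (a_ i)).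
  apply/polyP => i; rewrite coef_map coef_poly /=.
  case: ltnP => [_|le_i]; first by case: (a_ i).
  by rewrite scale0r nth_default.
have [p [-> mon_p] dvd_p] := minCpolyP (iota x).
apply/eqP; rewrite -eqp_monic ?map_monic ?monic_minPoly //; apply/andP; split.
  by rewrite -Dq alg_iota dvdp_map -dvd_p -alg_iota Dq fmorph_root root_minPoly.
rewrite -alg_iota dvdp_map minPoly_dvdp //.
  by apply/polyOverP => i; rewrite coef_map memvZ ?memv_line.
by rewrite -(fmorph_root iota) alg_iota dvd_p.
Qed.

(** Summing over a whole Galois group, rather than over conjugates, turns the mean
    square into a quadratic form on all of L. *)
Lemma mean_square_galois x :
  mean_square (iota x) =
    (\sum_(s in 'Gal({:L} / 1)%g) `|iota (s x)| ^+ 2) / #|'Gal({:L} / 1)%g|%:R.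
Proof.
have [c [rs [c_gt0 Drs sumE]]] := galois_orbit_sum (galois_rat 1) (memvf x).
have conjE : perm_eq (conjugates (iota x)) (map iota rs).
  apply/prod_XsubC_eq; rewrite -minCpoly_conjugates minCpoly_normal_field Drs big_map.
  by rewrite rmorph_prod; apply: eq_bigr => r _; rewrite /= map_polyXsubC.
have := sumE algC (fun=> 1); rewrite sumr_const big_const_seq count_predT.
rewrite iter_addr_0 -mulrnA => ->.
rewrite (sumE algC (fun y => `|iota y| ^+ 2)) /mean_square.
rewrite (perm_big _ conjE) (perm_size conjE) big_map size_map natrM.
by rewrite -[X in X / (_ * _)]mulr_natr -mulf_div divff ?mulr1 // pnatr_eq0 -lt0n.
Qed.

End NormalField.

Local Open Scope classical_set_scope.

(** * Homogeneous components *)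

Section Components.

Variables (R : idomainType) (G : zmodType) (P : G -> set R).
Hypothesis gP : is_grading P.

Lemma hom0 g : P g 0. Proof. by case: gP => /(_ g)[]. Qed.

Lemma homB g x y : P g x -> P g y -> P g (x - y).
Proof. by case: gP => /(_ g)[_ h] _ _; apply: h. Qed.

Lemma homN g x : P g x -> P g (- x).
Proof. by move=> Px; rewrite -sub0r; apply: homB => //; apply: hom0. Qed.

Lemma homD g x y : P g x -> P g y -> P g (x + y).
Proof. by move=> Px Py; rewrite -[y]opprK; apply: homB => //; apply: homN. Qed.

Lemma homM g h x y : P g x -> P h y -> P (g + h) (x * y).
Proof. by case: gP => _ _; apply. Qed.

Lemma hom_sum I (r : seq I) (p : pred I) (z : I -> R) g :
  (forall i, p i -> P g (z i)) -> P g (\sum_(i <- r | p i) z i).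
Proof.
by move=> Pz; elim/big_ind: _ => //; [apply: hom0 | move=> *; apply: homD].
Qed.

Definition decomposition (x : R) : {fsfun G -> R with 0} :=
  xget [fsfun] [set d | direct_sum P d /\ family_sum d = x].

Definition component (g : G) (x : R) : R := decomposition x g.

Lemma decompositionP x :
  direct_sum P (decomposition x) /\ family_sum (decomposition x) = x.
Proof.
case: gP => _ [_ _ /(_ x I)[d Pd dx]] _.
exact: (@xgetPex _ [fsfun] [set d | direct_sum P d /\ family_sum d = x]
  (ex_intro _ d (conj Pd dx))).
Qed.

Lemma decomposition_unique d : direct_sum P d -> decomposition (family_sum d) = d.
Proof.
move=> Pd; have [Pd' dd'] := decompositionP (family_sum d).
by case: gP => _ [_ injS _] _; apply: injS => //; rewrite ?inE.
Qed.

Lemma componentP g x : P g (component g x).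
Proof. by case: (decompositionP x) => Px _; apply: Px. Qed.

Lemma sum_components x :
  \sum_(g <- finsupp (decomposition x)) component g x = x.
Proof. by case: (decompositionP x). Qed.

Lemma family_sumE (d : {fsfun G -> R with 0}) (A : {fset G}) :
  (finsupp d `<=` A)%fset -> family_sum d = \sum_(g <- A) d g.
Proof.
move=> dA; rewrite /family_sum; apply: big_fset_incl => // g _ gd.
by rewrite fsfun_dflt.
Qed.

Lemma componentD g x y : component g (x + y) = component g x + component g y.
Proof.
pose A := (finsupp (decomposition x) `|` finsupp (decomposition y))%fset.
pose d := [fsfun g in A => component g x + component g y] : {fsfun G -> R with 0}.
have dE h : d h = component h x + component h y.
  rewrite /d fsfunE; case: ifP => // /negbT; rewrite in_fsetU negb_or => /andP[hx hy].
  by rewrite /component !fsfun_dflt ?addr0.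
have Pd : direct_sum P d by move=> h; rewrite dE; apply: homD; apply: componentP.
have <- : family_sum d = x + y.
  rewrite (@family_sumE _ A) ?finsupp_sub //.
  rewrite (eq_bigr _ (fun h _ => dE h)) big_split /= /component.
  rewrite -!family_sumE ?fsubsetUl ?fsubsetUr //.
  by rewrite (decompositionP x).2 (decompositionP y).2.
by rewrite /component decomposition_unique // dE.
Qed.

Lemma component_hom g h x : P h x -> component g x = if h == g then x else 0.
Proof.
move=> Px; pose d := [fsfun k in [fset h]%fset => x] : {fsfun G -> R with 0}.
have dE k : d k = if h == k then x else 0 by rewrite fsfunE in_fset1 eq_sym.
have Pd : direct_sum P d.
  by move=> k; rewrite dE; case: eqP => [<- //|_]; apply: hom0.
have {1}<- : family_sum d = x.
  by rewrite (@family_sumE _ [fset h]%fset) ?finsupp_sub // big_seq_fset1 dE eqxx.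
by rewrite /component decomposition_unique // dE.
Qed.

Lemma component0 g : component g 0 = 0.
Proof. by rewrite (component_hom _ (hom0 g)) if_same. Qed.

Lemma component_sum I (r : seq I) (p : pred I) (z : I -> R) g :
  component g (\sum_(i <- r | p i) z i) = \sum_(i <- r | p i) component g (z i).
Proof. exact: (big_morph _ (componentD g) (component0 g)). Qed.

Lemma component_sum_hom I (r : seq I) (p : pred I) (deg : I -> G) (z : I -> R) g :
  (forall i, p i -> P (deg i) (z i)) ->
  component g (\sum_(i <- r | p i) z i) = \sum_(i <- r | p i && (deg i == g)) z i.
Proof.
move=> Pz; rewrite component_sum big_mkcondr /=; apply: eq_bigr => i pi.
exact: component_hom (Pz i pi).
Qed.

Lemma hom_component g x : P g x <-> component g x = x.
Proof.
split=> [/(component_hom g) -> |<-]; first by rewrite eqxx.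
exact: componentP.
Qed.

Lemma degree_unique g h x : x != 0 -> P g x -> P h x -> g = h.
Proof.
move=> x0 Pg /(component_hom g); rewrite (component_hom g Pg) eqxx.
by case: eqP => // _ x0'; rewrite x0' eqxx in x0.
Qed.

Lemma componentM_hom g h x y : P h y -> component (g + h) (x * y) = component g x * y.
Proof.
move=> Py; rewrite -{1}(sum_components x) mulr_suml.
rewrite (@component_sum_hom _ _ _ (fun k => k + h)); last first.
  by move=> k _; apply: homM => //; apply: componentP.
rewrite (eq_bigl (fun k => k == g)) /=; last by move=> k; rewrite (inj_eq (addIr h)).
have [gx|gx] := boolP (g \in finsupp (decomposition x)).
  by rewrite big_mkcond (bigD1_seq g) ?fset_uniq //= eqxx big1 ?addr0 // => k /negPf->.
rewrite /component fsfun_dflt // mul0r big1_seq // => k /andP[/eqP->].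
by rewrite (negPf gx).
Qed.

(** If e is a nonzero component of 1, then the degree-zero component of 1 acts as
    the identity on e, so it is 1 by cancellation. *)
Lemma hom1 : P 0 1.
Proof.
have [g cg] : exists g, component g 1 != 0.
  apply: contrapT => nc; move: (oner_neq0 R).
  rewrite -(sum_components 1) big1 ?eqxx // => g _; apply/eqP/negPn/negP => cg.
  by apply: nc; exists g.
set e := component g 1 in cg.
have Pe : P g e := componentP g 1.
apply/hom_component; apply: (mulIf cg).
by rewrite -(componentM_hom 0 1 Pe) add0r !mul1r (component_hom _ Pe) eqxx.
Qed.

Lemma homX g x n : P g x -> P (g *+ n) (x ^+ n).
Proof.
move=> Px; elim: n => [|n IHn]; first exact: hom1.
by rewrite exprS mulrS; apply: homM.
Qed.

Lemma hom_nat n : P 0 n%:R.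
Proof.
elim: n => [|n IHn]; first exact: hom0.
by rewrite -addn1 natrD; apply: homD => //; apply: hom1.
Qed.

Lemma hom_int n : P 0 n%:~R.
Proof. by case: n => n; [|apply: homN]; apply: hom_nat. Qed.

Lemma hom0M g x y : P 0 x -> P g y -> P g (x * y).
Proof. by rewrite -{2}[g]add0r; apply: homM. Qed.

Lemma component0M g x y : P 0 x -> component g (x * y) = x * component g y.
Proof. by move=> Px; rewrite mulrC -{1}[g]addr0 componentM_hom // mulrC. Qed.

End Components.

(** * Gradings are orthogonal decompositions *)

Lemma sqr_normD (a b : algC) :
  `|a + b| ^+ 2 = `|a| ^+ 2 + `|b| ^+ 2 + (a * b^* + (a * b^*)^*).
Proof.
rewrite !normCK rmorphM /= conjCK rmorphD /= mulrDl !mulrDr -!addrA; congr (_ + _).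
by rewrite [a^* * b]mulrC [RHS]addrCA; congr (_ + _); rewrite addrC.
Qed.

Section EmbeddedGrading.

Variables (R : idomainType) (j : {rmorphism R -> algC}).
Hypotheses (j_inj : injective j) (j_int : forall x, j x \in Aint).

Lemma j_eq0 x : (j x == 0) = (x == 0).
Proof. by rewrite -(inj_eq j_inj) rmorph0. Qed.

Lemma integral_equation (x : R) : x != 0 ->
  exists p : {poly int}, [/\ p \is monic, size p = size (minCpoly (j x)),
    p`_0 != 0 & \sum_(i < size p) (p`_i)%:~R * x ^+ i = 0].
Proof.
move=> x0; have := j_int x; rewrite unfold_in => /floorpP[p Dp].
have szp : size p = size (minCpoly (j x)).
  by rewrite Dp size_map_inj_poly ?rmorph0 //; apply: intr_inj.
exists p; split=> //.
- have := monicP (minCpoly_monic (j x)).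
  rewrite Dp lead_coef_map_inj ?rmorph0 //; last exact: intr_inj.
  by move/eqP; rewrite -[X in _ == X]/(1%:~R) eqr_int -monicE.
- have := @minCpoly_coef0 (j x); rewrite j_eq0 => /(_ x0).
  by rewrite Dp coef_map intr_eq0.
apply: j_inj; rewrite rmorph0 rmorph_sum /=.
have /rootP := root_minCpoly (j x); rewrite Dp horner_coef.
rewrite size_map_inj_poly ?rmorph0 //; last exact: intr_inj.
move=> px; rewrite -{2}px; apply: eq_bigr => i _.
by rewrite coef_map rmorphM rmorphXn /= rmorph_int.
Qed.

(** A multiple of every positive exponent in the integral equation of x, so that it
    serves for all gradings at once. *)
Definition torsion_exponent (x : R) : nat := ((size (minCpoly (j x))).-1)`!.

Lemma torsion_exponent_gt0 x : (0 < torsion_exponent x)%N.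
Proof. exact: fact_gt0. Qed.

Variables (G : zmodType) (P : G -> set R).
Hypothesis gP : is_grading P.

(** In an integral equation of x with nonzero constant term, this constant has to
    cancel against some other term of degree zero, so x^i has degree zero for some
    i between 1 and the degree of the equation. *)
Lemma degree_torsion x g : x != 0 -> P g x -> g *+ torsion_exponent x = 0.
Proof.
move=> x0 Px; have [p [mon_p szp p0 px]] := integral_equation x0.
have szp_gt0 : (0 < size p)%N by rewrite szp ltnW ?size_minCpoly.
have Pterm (i : 'I_(size p)) : true -> P (g *+ i) ((p`_i)%:~R * x ^+ i).
  by move=> _; apply: (hom0M gP); [apply: hom_int | apply: homX].
have := component_sum_hom gP (index_enum _) 0 Pterm.
rewrite px component0 // => /esym.
have [[i /andP[i_gt0 /eqP gi]]|no_i] :=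
    pselect (exists i : 'I_(size p), (0 < i)%N && (g *+ i == 0)).
  move=> _; rewrite /torsion_exponent -szp.
  have : (i %| (size p).-1`!)%N.
    by apply: dvdn_fact; rewrite i_gt0 -ltnS prednK // ltn_ord.
  by case/dvdnP => k ->; rewrite mulnC mulrnA gi mul0rn.
rewrite (bigD1 (Ordinal szp_gt0)) ?mulr0n //= big1 => [|i /andP[/eqP gi i0]].
  rewrite expr0 mulr1 addr0 => /(congr1 j)/eqP; rewrite rmorph0 rmorph_int intr_eq0.
  by rewrite (negPf p0).
case: no_i; exists i; rewrite gi eqxx andbT lt0n.
by apply: contraNneq i0 => i0; apply/eqP/val_inj.
Qed.

(** The fraction field of the degree-zero subring, inside the complex numbers. *)
Definition degree0_fraction (c : algC) : Prop :=
  exists s t, [/\ P 0 s, P 0 t, t != 0 & c * j t = j s].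

Lemma degree0_fraction_j s : P 0 s -> degree0_fraction (j s).
Proof.
by move=> Ps; exists s, 1; split; rewrite ?oner_neq0 ?rmorph1 ?mulr1 //; apply: hom1.
Qed.

Lemma degree0_fractionD c c' :
  degree0_fraction c -> degree0_fraction c' -> degree0_fraction (c + c').
Proof.
move=> [s [t [Ps Pt t0 Dc]]] [s' [t' [Ps' Pt' t0' Dc']]].
exists (s * t' + s' * t), (t * t'); split.
- by apply: (homD gP); apply: (hom0M gP).
- exact: (hom0M gP).
- by rewrite mulf_neq0.
by rewrite rmorphD !rmorphM -Dc -Dc' mulrDl !mulrA [c' * _ * _]mulrAC.
Qed.

Lemma degree0_fractionM c c' :
  degree0_fraction c -> degree0_fraction c' -> degree0_fraction (c * c').
Proof.
move=> [s [t [Ps Pt t0 Dc]]] [s' [t' [Ps' Pt' t0' Dc']]].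
exists (s * s'), (t * t'); split; try exact: (hom0M gP).
  by rewrite mulf_neq0.
by rewrite !rmorphM -Dc -Dc' mulrACA.
Qed.

Lemma degree0_fraction_rat (a : rat) : degree0_fraction (ratr a).
Proof.
exists (numq a)%:~R, (denq a)%:~R; split; try exact: (hom_int gP).
  by rewrite -j_eq0 rmorph_int intr_eq0 denq_neq0.
rewrite !rmorph_int -!(rmorph_int (@ratr algC)) -rmorphM /=.
by rewrite -{1}[a]divq_num_den divfK // intr_eq0 denq_neq0.
Qed.

Lemma degree0_fractionX c n : degree0_fraction c -> degree0_fraction (c ^+ n).
Proof.
move=> Kc; elim: n => [|n IHn]; last by rewrite exprS; apply: degree0_fractionM.
by rewrite expr0 -(rmorph1 (@ratr algC)); apply: degree0_fraction_rat.
Qed.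

Lemma degree0_fraction_sum n (c : 'I_n -> algC) :
  (forall i, degree0_fraction (c i)) -> degree0_fraction (\sum_i c i).
Proof.
move=> Kc; elim/big_ind: _ => //; last exact: degree0_fractionD.
by rewrite -(rmorph0 (@ratr algC)); apply: degree0_fraction_rat.
Qed.

Lemma common_denominator n (c : nat -> algC) :
    (forall i, (i < n)%N -> degree0_fraction (c i)) ->
  exists t, [/\ P 0 t, t != 0 &
    forall i, (i < n)%N -> exists2 s, P 0 s & c i * j t = j s].
Proof.
elim: n => [|n IHn] Kc.
  by exists 1; split; rewrite ?oner_neq0 //; apply: hom1.
have [i ltin|t [Pt t0 Dc]] := IHn; first by apply: Kc; rewrite ltnW.
have [s' [t' [Ps' Pt' t0' Dc']]] := Kc n (ltnSn n).
exists (t * t'); split; rewrite ?mulf_neq0 //; first exact: (hom0M gP).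
move=> i; rewrite ltnS leq_eqVlt => /predU1P[->|/Dc[s Ps Dci]].
  by exists (s' * t); [apply: (hom0M gP) | rewrite !rmorphM -Dc' mulrCA mulrC mulrAC].
by exists (s * t'); [apply: (hom0M gP) | rewrite !rmorphM -Dci mulrA].
Qed.

Section Orthogonality.

Variables (L : splittingFieldType rat) (iota : {rmorphism L -> algC}).
Variables (g h : G) (y z : R) (Y Z : L).
Hypotheses (Py : P g y) (Pz : P h z) (neq_gh : g != h) (z0 : z != 0).
Hypotheses (DY : iota Y = j y) (DZ : iota Z = j z).

Let n := torsion_exponent z.
Let K := <<1; Z ^+ n>>%AS.
Let u := Y / Z.

Lemma Z_neq0 : Z != 0.
Proof. by rewrite -(fmorph_eq0 iota) DZ j_eq0. Qed.

(** The power z^n has degree zero, so it generates a subfield of the fraction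
    field of the degree-zero subring. *)
Lemma degree0_subfield a : a \in K -> degree0_fraction (iota a).
Proof.
case/Fadjoin_polyP => p /polyOverP Kp ->; rewrite horner_coef rmorph_sum.
apply: degree0_fraction_sum => i /=; rewrite rmorphM; apply: degree0_fractionM.
  have /vlineP[b ->] := Kp i.
  by rewrite alg_num_field fmorph_rat; apply: degree0_fraction_rat.
rewrite rmorphXn rmorphXn DZ -rmorphXn; apply: degree0_fractionX.
by apply: degree0_fraction_j; rewrite -(degree_torsion z0 Pz); apply: homX.
Qed.

(** The homogeneous part f' of the minimal polynomial f of u, which consists of the
    terms of the same degree as the leading one, still vanishes at u, so f' = f.
    The second coefficient of f' is zero because u has nonzero degree, and this
    coefficient is, up to sign and multiplicity, the trace of u. *)
Lemma trace_eq0 : \sum_(r in 'Gal({:L} / K)%g) r u = 0.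
Proof.
set f := minPoly K u; set e := (size f).-1; pose d := g - h.
have szf : size f = e.+1 by rewrite /e prednK // size_poly_gt0 monic_neq0 ?monic_minPoly.
have szf_gt1 : (1 < size f)%N.
  by apply: root_size_gt1 (root_minPoly K u); rewrite monic_neq0 ?monic_minPoly.
have Kf : f \is a polyOver K := minPolyOver K u.
pose f' := \poly_(i < size f) (if d *+ i == d *+ e then f`_i else 0).
have Kf' : f' \is a polyOver K.
  apply/polyOverP => i; rewrite coef_poly.
  by do 2![case: ifP => _; rewrite ?rpred0 //]; apply/polyOverP.
have root_f' : root f' u.
  have [i ltif|t [Pt t0 Dt]] := @common_denominator (size f) (fun i => iota f`_i).
    by apply/degree0_subfield/polyOverP.
  pose s i := xget 0 [set s | P 0 s /\ iota f`_i * j t = j s].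
  have sP (i : 'I_(size f)) : P 0 (s i) /\ iota f`_i * j t = j (s i).
    by have [s0 Ps0 Ds0] := Dt i (ltn_ord i);
      exact: (@xgetPex _ 0 [set s | P 0 s /\ iota f`_i * j t = j s] (ex_intro _ s0 (conj Ps0 Ds0))).
  pose w (i : 'I_(size f)) := s i * (y ^+ i * z ^+ (e - i)).
  have le_ie (i : 'I_(size f)) : (i <= e)%N by rewrite -ltnS -szf.
  have jw (i : 'I_(size f)) : j (w i) = iota (f`_i * u ^+ i) * (j t * j z ^+ e).
    rewrite /w rmorphM -(sP i).2 !rmorphM !rmorphXn /= -DY -DZ /u rmorphM fmorphV.
    rewrite -{2}(subnKC (le_ie i)) exprD expr_div_n.
    have Z0 : iota Z != 0 by rewrite fmorph_eq0 Z_neq0.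
    by rewrite [RHS]mulrACA [X in _ = _ * X]mulrA divfK ?expf_neq0.
  have sumw : \sum_i w i = 0.
    apply: j_inj; rewrite rmorph_sum rmorph0 (eq_bigr _ (fun i _ => jw i)) -mulr_suml.
    by rewrite -rmorph_sum -horner_coef (rootP (root_minPoly K u)) rmorph0 mul0r.
  have Pw (i : 'I_(size f)) : true -> P (g *+ i + h *+ (e - i)) (w i).
    by move=> _; apply: (hom0M gP); [case: (sP i) | apply: (homM gP); apply: (homX gP)].
  have := component_sum_hom gP (index_enum _) (g *+ e) Pw.
  rewrite sumw component0 // => /(congr1 j); rewrite rmorph0 rmorph_sum.
  rewrite (eq_bigr _ (fun i _ => jw i)) -mulr_suml -rmorph_sum => /esym/eqP.
  rewrite mulf_eq0 fmorph_eq0 mulf_eq0 expf_eq0 !j_eq0 (negPf z0) (negPf t0) andbF !orbF.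
  rewrite /root horner_poly; congr (_ == 0); rewrite big_mkcond; apply: eq_bigr => i _ /=.
  rewrite -(subrK h g) -/d !mulrnDl -addrA -mulrnDr subnKC // (inj_eq (addIr _)).
  by case: ifP => _; rewrite ?mul0r.
have Df : f = f'.
  apply/eqP; rewrite -subr_eq0; apply/negPn/negP => ff'0.
  have: f %| f - f'.
    apply: minPoly_dvdp; first exact: rpredB.
    by apply/rootP; rewrite hornerD hornerN (rootP root_f') (rootP (root_minPoly K u)) subr0.
  move/(dvdp_leq ff'0); apply/negP; rewrite -ltnNge szf ltnS.
  apply/leq_sizeP => i; rewrite leq_eqVlt => /predU1P[<-|lt_ei].
    by rewrite coefB coef_poly szf ltnSn eqxx subrr.
  by rewrite coefB coef_poly szf ltnS leqNgt lt_ei nth_default ?subr0 ?szf.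
have f_e1 : f`_e.-1 = 0.
  rewrite Df coef_poly; case: ifP => // _; case: eqP => // de.
  have e_gt0 : (0 < e)%N by rewrite -ltnS -szf.
  have /eqP : d = 0 by rewrite -(addKr (d *+ e.-1) d) -mulrSr prednK // de addNr.
  by rewrite subr_eq0 (negPf neq_gh).
have [c [rs [_ Drs sumE]]] := galois_orbit_sum (galois_rat K) (memvf u).
have szrs : size rs = e by apply/eqP; rewrite -eqSS -szf /f Drs size_prod_XsubC.
rewrite (sumE L id); have := @coefPn_prod_XsubC _ rs; rewrite -Drs -/f szrs f_e1.
rewrite -lt0n -ltnS -szf => /(_ szf_gt1)/esym/eqP.
by rewrite oppr_eq0 => /eqP->; rewrite mul0rn.
Qed.

(** The absolute value of a conjugate of Z is determined by that of Z^n, on which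
    the group of L over K acts trivially. *)
Lemma normX_const r : r \in 'Gal({:L} / K)%g ->
  forall s : {rmorphism L -> algC}, `|s (r Z)| = `|s Z|.
Proof.
move=> Kr s; have n_gt0 := torsion_exponent_gt0 z.
have rZn : r Z ^+ n = Z ^+ n.
  by rewrite -rmorphXn /= (fixed_gal (subvf K) Kr) // memv_adjoin.
by apply: (pexpIrn n_gt0); rewrite ?nnegrE // -!normrX -(rmorphXn s) rZn rmorphXn.
Qed.

(** Write the conjugate of s Z as |s Z|^2 / s Z. Averaging over the cosets of the
    group of L over K then leaves a factor equal to the trace of u = Y / Z. *)
Lemma graded_orthogonal :
  \sum_(s in 'Gal({:L} / 1)%g) iota (s Y) * (iota (s Z))^* = 0.
Proof.
pose F (s : gal_of {:L}) := iota (s Y) * (iota (s Z))^*.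
have FE s : F s = iota (s u) * `|iota (s Z)| ^+ 2.
  by rewrite normCK mulrA -rmorphM -rmorphM divfK // Z_neq0.
have galK_gt0 : (0 < #|'Gal({:L} / K)%g|)%N by apply: cardG_gt0.
(* Multiply by the order of the group of L over K to sum over it first. *)
apply: (mulIf (_ : #|'Gal({:L} / K)%g|%:R != 0 :> algC)).
  by rewrite pnatr_eq0 -lt0n.
rewrite mul0r mulr_natr -sumr_const.
transitivity (\sum_(r in 'Gal({:L} / K)%g) \sum_(s in 'Gal({:L} / 1)%g) F (r * s)%g).
  apply: eq_bigr => r Kr; have Gr : r \in 'Gal({:L} / 1)%g.
    by apply: (fintype.subsetP (galS _ (sub1v K))).
  rewrite (reindex_inj (mulgI r)) /=; apply: eq_bigl => s.
  by rewrite groupMl.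
rewrite exchange_big big1 // => s _.
have -> : \sum_(r in 'Gal({:L} / K)%g) F (r * s)%g =
          iota (s (\sum_(r in 'Gal({:L} / K)%g) r u)) * `|iota (s Z)| ^+ 2.
  rewrite !rmorph_sum mulr_suml; apply: eq_bigr => r Kr.
  rewrite FE !galM ?memvf //; congr (_ * _ ^+ 2).
  exact: (normX_const Kr (iota \o s)).
by rewrite trace_eq0 !rmorph0 mul0r.
Qed.

End Orthogonality.

(** Pythagoras, since the component of degree g is orthogonal to the others. *)
Lemma mean_square_component g (x : R) :
  mean_square (j x) =
  mean_square (j (component P g x)) + mean_square (j (x - component P g x)).
Proof.
(* The number field L contains all components of x and that of degree g, which may vanish. *)
pose A := finsupp (decomposition P x).
have [L [iota inL]] := normal_number_field
  [seq j (component P h x) | h <- g :: A].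
pose lift h := xget 0 [set Y | j (component P h x) = iota Y].
have liftP h : h \in g :: A -> iota (lift h) = j (component P h x).
  move=> Ah; have [|Y DY] := inL (j (component P h x)).
    exact: (map_f (fun h => j (component P h x))).
  exact/esym/(@xgetPex _ 0 [set Y | j (component P h x) = iota Y] (ex_intro _ Y DY)).
pose Y := lift g; pose Z := \sum_(h <- A | h != g) lift h.
have DY : iota Y = j (component P g x) by rewrite liftP ?mem_head.
have DZ : iota Z = j (x - component P g x).
  rewrite -{1}(sum_components gP x) -/A rmorph_sum big_seq_cond.
  rewrite (eq_bigr (fun h => j (component P h x))) => [|h /andP[Ah _]]; last first.
    by rewrite liftP // inE Ah orbT.
  rewrite -big_seq_cond -rmorph_sum; congr (j _).
  have [Ag|nAg] := boolP (g \in A).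
    by rewrite (bigD1_seq g) ?fset_uniq //= [RHS]addrC addKr.
  have -> : component P g x = 0 by rewrite /component fsfun_dflt.
  rewrite subr0 big_seq_cond [RHS]big_seq.
  by apply: eq_bigl => h; have [->|_] := eqVneq h g; rewrite ?(negPf nAg) ?andbT.
have DX : iota (Y + Z) = j x by rewrite rmorphD DY DZ -rmorphD addrC subrK.
rewrite -DX -DY -DZ !mean_square_galois -mulrDl -big_split; congr (_ / _).
pose T W := \sum_(s in 'Gal({:L} / 1)%g) iota (s Y) * (iota (s W))^*.
have TZ : T Z = 0.
  have -> : T Z = \sum_(h <- A | h != g) T (lift h).
    rewrite exchange_big; apply: eq_bigr => s _.
    by rewrite -mulr_sumr -!rmorph_sum.
  rewrite big_seq_cond big1 // => h /andP[Ah neq_hg].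
  have Dh : iota (lift h) = j (component P h x) by rewrite liftP // inE Ah orbT.
  have [ch0|ch_neq0] := eqVneq (component P h x) 0.
    have -> : lift h = 0 by apply: (fmorph_inj iota); rewrite Dh ch0 !rmorph0.
    by rewrite /T big1 // => s _; rewrite !rmorph0 mulr0.
  by apply: (graded_orthogonal (componentP gP g x) (componentP gP h x) _ ch_neq0 DY Dh);
     rewrite eq_sym.
transitivity (\sum_(s in 'Gal({:L} / 1)%g) (`|iota (s Y)| ^+ 2 + `|iota (s Z)| ^+ 2)
   + (T Z + (T Z)^*)); last by rewrite TZ rmorph0 !addr0.
rewrite rmorph_sum -!big_split; apply: eq_bigr => s _.
rewrite !rmorphD; exact: sqr_normD.
Qed.

End EmbeddedGrading.

(** * The universal grading *)

Section UniversalGrading.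

Variables (R : idomainType) (j : {rmorphism R -> algC}).
Hypotheses (j_inj : injective j) (j_int : forall x, j x \in Aint).

Definition universally_homogeneous (x : R) : Prop :=
  forall (H : zmodType) (Q : H -> set R), is_grading Q -> exists h, Q h x.

(** An element that is not homogeneous for some grading splits into two nonzero
    parts, each of mean square at most that of the whole minus 1; so the splitting
    process stops. *)
Lemma universally_homogeneous_sum (x : R) :
  exists2 s : seq R, x = \sum_(y <- s) y &
    forall y, y \in s -> y != 0 /\ universally_homogeneous y.
Proof.
have [n ltn] : exists n, mean_square (j x) < n%:R.
  by exists (Num.bound (mean_square (j x))); apply: archi_boundP; apply: mean_square_ge0.
elim: n => [|n IHn] in x ltn *.
  by have := le_lt_trans (mean_square_ge0 _) ltn; rewrite ltxx.
have [->|x0] := eqVneq x 0; first by exists [::]; rewrite ?big_nil.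
have [xh|/existsNP[H /existsNP[Q /not_implyP[gQ nhom]]]] :=
    pselect (universally_homogeneous x).
  by exists [:: x]; rewrite ?big_seq1 // => y; rewrite inE => /eqP->.
have [h ch0] : exists h, component Q h x != 0.
  apply: contrapT => nc; case/eqP: x0; rewrite -(sum_components gQ x) big1 // => h _.
  by apply/eqP/negPn/negP => ch; apply: nc; exists h.
have cN0 : x - component Q h x != 0.
  rewrite subr_eq0; apply/eqP => cx; apply: nhom; exists h; rewrite cx.
  exact: componentP.
have ms_split := mean_square_component j_inj j_int gQ h x.
have ge1 := mean_square_ge1 (j_int _).
have [|s1 Ds1 s1h] := IHn (component Q h x).
  rewrite -(ltrD2r 1) natr1 (le_lt_trans _ ltn) // ms_split lerD2l ge1 //.
  by rewrite (j_eq0 j_inj).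
have [|s2 Ds2 s2h] := IHn (x - component Q h x).
  rewrite -(ltrD2r 1) natr1 (le_lt_trans _ ltn) // ms_split addrC lerD2r ge1 //.
  by rewrite (j_eq0 j_inj).
exists (s1 ++ s2); first by rewrite big_cat -Ds1 -Ds2 /= addrC subrK.
by move=> y; rewrite mem_cat => /orP[/s1h|/s2h].
Qed.

Lemma universally_homogeneous1 : universally_homogeneous 1.
Proof. by move=> H Q gQ; exists 0; apply: hom1. Qed.

Lemma universally_homogeneousM x y : universally_homogeneous x ->
  universally_homogeneous y -> universally_homogeneous (x * y).
Proof.
move=> hx hy H Q gQ; have [[h Qx] [k Qy]] := (hx H Q gQ, hy H Q gQ).
by exists (h + k); apply: homM.
Qed.

Lemma universally_homogeneousX x n :
  universally_homogeneous x -> universally_homogeneous (x ^+ n).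
Proof. by move=> hx H Q gQ; have [h Qx] := hx H Q gQ; exists (h *+ n); apply: homX. Qed.

Definition hom_pred : {pred R} := fun x => `[< x != 0 /\ universally_homogeneous x >].

Definition hom_elt := {x : R | x \in hom_pred}.

Lemma hom_elt_neq0 (x : hom_elt) : val x != 0.
Proof. by case: x => x /= /asboolP[]. Qed.

Lemma hom_eltP (x : hom_elt) : universally_homogeneous (val x).
Proof. by case: x => x /= /asboolP[]. Qed.

Lemma hom_pred1 : 1 \in hom_pred.
Proof. by apply/asboolP; split; [apply: oner_neq0 | apply: universally_homogeneous1]. Qed.

Lemma hom_predM (x y : hom_elt) : val x * val y \in hom_pred.
Proof.
apply/asboolP; split; first by rewrite mulf_neq0 ?hom_elt_neq0.
by apply: universally_homogeneousM; apply: hom_eltP.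
Qed.

Lemma hom_predX (x : hom_elt) n : val x ^+ n \in hom_pred.
Proof.
apply/asboolP; split; first by rewrite expf_neq0 ?hom_elt_neq0.
by apply: universally_homogeneousX; apply: hom_eltP.
Qed.

Definition hom_one : hom_elt := Sub 1 hom_pred1.
Definition hom_mul (x y : hom_elt) : hom_elt := Sub (val x * val y) (hom_predM x y).
(** The product with x is a power of x that has degree zero in every grading. *)
Definition hom_inv (x : hom_elt) : hom_elt :=
  Sub (val x ^+ (torsion_exponent j (val x)).-1) (hom_predX x _).

Definition same_degree : rel hom_elt := fun x y =>
  `[< forall (H : zmodType) (Q : H -> set R), is_grading Q ->
        forall h, Q h (val x) -> Q h (val y) >].

Lemma same_degreeP (x y : hom_elt) :
  same_degree x y <-> forall (H : zmodType) (Q : H -> set R), is_grading Q ->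
        forall h k, Q h (val x) -> Q k (val y) -> h = k.
Proof.
split=> [/asboolP xy H Q gQ h k Qx Qy | xy].
  exact: (degree_unique gQ (hom_elt_neq0 y) (xy _ _ gQ _ Qx) Qy).
apply/asboolP => H Q gQ h Qx; have [k Qy] := hom_eltP y gQ.
by rewrite (xy H Q gQ h k Qx Qy).
Qed.

Lemma same_degree_equiv : equiv_class_of same_degree.
Proof.
split=> [x | x y | y x z].
- exact/asboolP.
- by apply/idP/idP => /same_degreeP xy; apply/same_degreeP => H Q gQ h k Qy Qx;
    rewrite (xy H Q gQ k h).
- by move=> /asboolP xy /asboolP yz; apply/asboolP => H Q gQ h /(xy _ _ gQ)/(yz _ _ gQ).
Qed.

Canonical same_degree_rel := EquivRelPack same_degree_equiv.

Definition degree_class := {eq_quot same_degree}%qT.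

HB.instance Definition _ := Choice.copy degree_class {eq_quot same_degree}%qT.

Definition class_of (x : hom_elt) : degree_class := (\pi_degree_class x)%qT.

Lemma class_ofP x y : (class_of x = class_of y) <-> same_degree x y.
Proof. by split=> /eqmodP. Qed.

Lemma class_of_repr a : class_of (repr a) = a.
Proof. exact: reprK. Qed.

Definition class_add (a b : degree_class) := class_of (hom_mul (repr a) (repr b)).
Definition class_opp (a : degree_class) := class_of (hom_inv (repr a)).

Lemma class_addE x y : class_add (class_of x) (class_of y) = class_of (hom_mul x y).
Proof.
have /class_ofP/same_degreeP ex := class_of_repr (class_of x).
have /class_ofP/same_degreeP ey := class_of_repr (class_of y).
apply/class_ofP/same_degreeP => H Q gQ h k Qh Qk.
have [[hx Qx] [hy Qy]] := (hom_eltP x gQ, hom_eltP y gQ).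
have [[hx' Qx'] [hy' Qy']] :=
  (hom_eltP (repr (class_of x)) gQ, hom_eltP (repr (class_of y)) gQ).
rewrite (degree_unique gQ (hom_elt_neq0 (hom_mul x y)) Qk (homM gQ Qx Qy)).
rewrite (degree_unique gQ (hom_elt_neq0 _) Qh (homM gQ Qx' Qy')).
by rewrite (ex _ _ gQ _ _ Qx' Qx) (ey _ _ gQ _ _ Qy' Qy).
Qed.

Lemma class_eq x y : (forall (H : zmodType) (Q : H -> set R), is_grading Q ->
    forall h, Q h (val x) -> Q h (val y)) -> class_of x = class_of y.
Proof. by move=> xy; apply/class_ofP/asboolP. Qed.

Lemma class_addA : associative class_add.
Proof.
move=> a b c; rewrite -[a]class_of_repr -[b]class_of_repr -[c]class_of_repr !class_addE.
by apply: class_eq => H Q gQ h /=; rewrite mulrA.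
Qed.

Lemma class_addC : commutative class_add.
Proof.
move=> a b; rewrite -[a]class_of_repr -[b]class_of_repr !class_addE.
by apply: class_eq => H Q gQ h /=; rewrite mulrC.
Qed.

Lemma class_add0 : left_id (class_of hom_one) class_add.
Proof.
move=> a; rewrite -[a]class_of_repr class_addE.
by apply: class_eq => H Q gQ h /=; rewrite mul1r.
Qed.

Lemma class_addN : left_inverse (class_of hom_one) class_opp class_add.
Proof.
move=> a; rewrite -{2}[a]class_of_repr class_addE.
apply/class_ofP/same_degreeP => H Q gQ h k Qh Q1.
rewrite (degree_unique gQ (oner_neq0 _) Q1 (hom1 gQ)).
have [hx Qx] := hom_eltP (repr a) gQ.
have := degree_torsion j_inj j_int gQ (hom_elt_neq0 (repr a)) Qx.
rewrite /= -exprSr prednK ?torsion_exponent_gt0 // in Qh => <-.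
exact: (degree_unique gQ (expf_neq0 _ (hom_elt_neq0 (repr a))) Qh (homX gQ _ Qx)).
Qed.

Definition universal_group : zmodType :=
  HB.pack degree_class
    (GRing.isZmodule.Build degree_class class_addA class_addC class_add0 class_addN).

(** This set consists of zero and the elements of the class a; the description as
    an intersection shows at once that it is an additive subgroup. *)
Definition universal_family (a : universal_group) : set R :=
  [set y | forall (H : zmodType) (Q : H -> set R), is_grading Q ->
     forall h, Q h (val (repr (a : degree_class))) -> Q h y].

End UniversalGrading.

Section UniversalGradingProof.

Variables (R : idomainType) (j : {rmorphism R -> algC}).
Hypotheses (j_inj : injective j) (j_int : forall x, j x \in Aint).

Local Notation G := (universal_group j_inj j_int).
Local Notation P := (@universal_family R j j_inj j_int).
Local Notation rep a := (val (repr (a : degree_class R))).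

Lemma universal_family_repr (a : G) : P a (rep a).
Proof. by move=> H Q. Qed.

Lemma universal_family_class (x : hom_elt R) : P (class_of x) (val x).
Proof.
have /class_ofP/asboolP xx := class_of_repr (class_of x).
by move=> H Q gQ h; apply: xx.
Qed.

Lemma universal_group_degreeD (a b : G) (H : zmodType) (Q : H -> set R) h k :
  is_grading Q -> Q h (rep a) -> Q k (rep b) -> Q (h + k) (rep (a + b)).
Proof.
move=> gQ Qa Qb; have /class_ofP/same_degreeP ab := class_of_repr (a + b).
have [l Ql] := hom_eltP (repr (a + b : degree_class R)) gQ.
by rewrite -(ab H Q gQ _ _ Ql (homM gQ Qa Qb)).
Qed.

Lemma universal_family_sub (a : G) (H : zmodType) (Q : H -> set R) :
  is_grading Q -> exists2 h, Q h (rep a) & P a `<=` Q h.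
Proof.
move=> gQ; have [h Qa] := hom_eltP (repr (a : degree_class R)) gQ.
by exists h => // y Py; apply: Py gQ _ Qa.
Qed.

Lemma universal_family_subgroup (a : G) : additive_subgroup (P a).
Proof.
split=> [|x y Px Py] H Q gQ h Qa; first exact: hom0.
by apply: homB => //; [apply: Px gQ _ Qa | apply: Py gQ _ Qa].
Qed.

Lemma universal_familyM (a b : G) x y : P a x -> P b y -> P (a + b) (x * y).
Proof.
move=> Px Py H Q gQ h Qab.
have [ha Qa sPa] := universal_family_sub a gQ.
have [hb Qb sPb] := universal_family_sub b gQ.
have -> : h = ha + hb.
  apply: (degree_unique gQ _ Qab (universal_group_degreeD gQ Qa Qb)).
  exact: hom_elt_neq0.
by apply: homM => //; [apply: sPa | apply: sPb].
Qed.

(** Two distinct classes are separated by some grading, whose components split the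
    sum into two shorter sums that also vanish. *)
Lemma universal_family_independent (s : seq G) (y : G -> R) :
    uniq s -> (forall a, P a (y a)) -> \sum_(a <- s) y a = 0 ->
  forall a, a \in s -> y a = 0.
Proof.
move=> + Py; have [n] := ubnP (size s); elim: n => // n IHn in s *.
rewrite ltnS => le_sn Us sum0 a sa.
have [same|/existsNP[b /not_implyP[sb neq_ab]]] :=
    pselect (forall b, b \in s -> b = a).
  move: sum0; rewrite (bigD1_seq a) //= big_seq_cond big1 ?addr0 // => b /andP[sb].
  by rewrite (same b sb) eqxx.
have [H [Q [gQ [h [k [Qa Qb neq_hk]]]]]] : exists (H : zmodType) (Q : H -> set R),
    is_grading Q /\ exists h k, [/\ Q h (rep a), Q k (rep b) & h <> k].
  apply: contrapT => no_sep; apply: neq_ab.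
  rewrite -[b](class_of_repr (b : degree_class R)) -[a](class_of_repr (a : degree_class R)).
  apply/class_ofP/same_degreeP => H Q gQ k h Qb Qa; apply: contrapT => neq_kh.
  by apply: no_sep; exists H, Q; split=> //; exists h, k; split=> // hk; apply: neq_kh.
pose deg c := xget 0 [set l | Q l (rep c)].
have degP c : Q (deg c) (rep c) /\ P c `<=` Q (deg c).
  have [l Ql sPl] := universal_family_sub c gQ.
  have Qd : Q (deg c) (rep c) := @xgetPex _ 0 [set l | Q l (rep c)] (ex_intro _ l Ql).
  split=> //; rewrite (degree_unique gQ _ Qd Ql) //; exact: hom_elt_neq0.
have deg_a : deg a = h.
  by apply: (degree_unique gQ _ (degP a).1 Qa); apply: hom_elt_neq0.
have deg_b : deg b = k.
  by apply: (degree_unique gQ _ (degP b).1 Qb); apply: hom_elt_neq0.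
have Qy c : true -> Q (deg c) (y c) by move=> _; apply: (degP c).2.
have := component_sum_hom gQ s h Qy; rewrite sum0 component0 // => /esym.
rewrite -big_filter => sum0h; apply: (IHn _ _ (filter_uniq _ Us) sum0h); last first.
  by rewrite mem_filter deg_a eqxx.
apply: leq_trans le_sn; rewrite size_filter -(count_predC (fun c => deg c == h) s).
rewrite -[X in (X < _)%N]addn0 ltn_add2l -has_count; apply/hasP; exists b => //=.
by rewrite deg_b; apply/eqP => kh; apply: neq_hk.
Qed.

Lemma universal_family_grading : is_grading P.
Proof.
split; [exact: universal_family_subgroup | | exact: universal_familyM].
split=> [d _ // | d d' | x _].
- rewrite !inE => Pd Pd' eq_sum; apply/fsfunP => a.
  pose A := (finsupp d `|` finsupp d')%fset.
  have [Aa|] := boolP (a \in A); last first.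
    by rewrite in_fsetU negb_or => /andP[da da']; rewrite !fsfun_dflt.
  apply/eqP; rewrite -subr_eq0; apply/eqP.
  apply: (@universal_family_independent A (fun b => d b - d' b)) Aa.
  + exact: fset_uniq.
  + by move=> b; have [_ PB] := universal_family_subgroup b; apply: PB.
  by rewrite sumrB -!family_sumE ?fsubsetUl ?fsubsetUr // eq_sum subrr.
have [s Dx hs] := universally_homogeneous_sum j_inj j_int x.
pose cls (y : R) : G := class_of (insubd (hom_one R) y).
have clsP y : y \in s -> P (cls y) y.
  move=> /hs hy; rewrite -{2}(_ : val (insubd (hom_one R) y) = y).
    exact: universal_family_class.
  by rewrite insubdK //; apply/asboolP.
have [A memA] : exists A : {fset G}, forall a, (a \in A) = (a \in map cls s).
  by exists (seq_fset tt (map cls s)) => a; rewrite seq_fsetE.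
pose d := [fsfun a in A => \sum_(y <- s | cls y == a) y] : {fsfun G -> R with 0}.
have dE a : d a = \sum_(y <- s | cls y == a) y.
  rewrite /d fsfunE; case: ifP => // /negbT; rewrite memA => nsa.
  rewrite big_seq_cond big1 // => y /andP[sy /eqP Dy].
  by rewrite -Dy map_f in nsa.
exists d.
  move=> a; rewrite dE big_seq_cond; have [P0 PB] := universal_family_subgroup a.
  elim/big_ind: _ => // [u v Pu Pv|y /andP[sy /eqP <-]]; last exact: clsP.
  by rewrite -[v]opprK; apply: (PB) => //; rewrite -sub0r; apply: PB.
rewrite (@family_sumE _ _ d A) ?finsupp_sub // (eq_bigr _ (fun a _ => dE a)).
rewrite (exchange_big_dep xpredT) //= [RHS]Dx big_seq [RHS]big_seq.
apply: eq_bigr => y sy; rewrite (eq_bigl (pred1 (cls y))) => [|a]; last exact: eq_sym.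
rewrite big_mkcond (bigD1_seq (cls y)) ?fset_uniq //= ?eqxx ?big1 ?addr0 //.
  by move=> a /negPf->.
by rewrite memA map_f.
Qed.

(** A class is sent to the common degree of its elements in the given grading. *)
Lemma universal_family_universal : is_universal_grading P.
Proof.
split=> [|H Q gQ]; first exact: universal_family_grading.
have gP := universal_family_grading.
pose f (a : G) := xget 0 [set l | Q l (rep a)].
have fQ a l : Q l (rep a) -> f a = l.
  move=> Ql; have Qf : Q (f a) (rep a) := @xgetPex _ 0 [set l | Q l (rep a)] (ex_intro _ l Ql).
  by rewrite (degree_unique gQ _ Qf Ql) //; apply: hom_elt_neq0.
have fP a : Q (f a) (rep a) /\ P a `<=` Q (f a).
  by have [l Ql sPl] := universal_family_sub a gQ; rewrite (fQ a l Ql).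
have fD a b : f (a + b) = f a + f b.
  by apply: fQ; apply: universal_group_degreeD; case: (fP a); case: (fP b).
have fB : zmod_morphism f.
  by move=> a b; apply: (addIr (f b)); rewrite -fD !subrK.
pose fA : {additive G -> H} := HB.pack f (GRing.isZmodMorphism.Build G H f fB).
exists fA; split=> [h | f' rf' a].
  apply/seteqP; split=> [y Qy | _ [d [Pd sd] <-]].
    exists (decomposition P y); last by rewrite (decompositionP gP y).2.
    split=> [|a]; first exact: (decompositionP gP y).1.
    rewrite mem_finsupp => da; apply: contrapT => neq_fh; case/eqP: da.
    set A := finsupp (decomposition P y).
    have [Aa|] := boolP (a \in A); last exact: fsfun_dflt.
    have Qd b : true -> Q (f b) (component P b y).
      by move=> _; apply: (fP b).2; apply: componentP.
    have := component_sum_hom gQ A (f a) Qd.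
    rewrite sum_components // (component_hom gQ _ Qy); case: eqP => [hfa|_].
      by case: neq_fh; rewrite /= -hfa.
    move/esym; rewrite -big_filter => /universal_family_independent; apply.
    - by rewrite filter_uniq ?fset_uniq.
    - by move=> b; apply: componentP.
    - by rewrite mem_filter eqxx.
  rewrite /family_sum big_seq; apply: (hom_sum gQ) => a /sd /= <-.
  by apply: (fP a).2; apply: Pd.
apply/esym/fQ; rewrite (rf' (f' a)).
exists (decomposition P (rep a)); last by rewrite (decompositionP gP _).2.
split=> [|b]; first exact: (decompositionP gP _).1.
rewrite mem_finsupp -/(component P b _) (component_hom gP _ (@universal_family_repr a)).
by have [->|_] := eqVneq a b; rewrite ?eqxx.
Qed.

End UniversalGradingProof.

(** * Embedding a torsion group of rank one into Q/Z *)

Local Open Scope quotient_scope.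

Definition intq := GRing.ZmodClosed.clone rat (@Num.int_num_subdef rat) _.
Definition qz (x : rat) : QmodZ := \pi_(Quotient.quot intq) x.

Lemma qzB : zmod_morphism qz.
Proof.
move=> x y; have := @Quotient.pi_add _ intq x (- y); have := @Quotient.pi_opp _ intq y.
by rewrite /qz => -> ->.
Qed.

HB.instance Definition _ := GRing.isZmodMorphism.Build rat QmodZ qz qzB.

Lemma qz_surj (q : QmodZ) : exists x, q = qz x.
Proof. by exists (repr (q : Quotient.quot intq)); rewrite /qz reprK. Qed.

Lemma qz_eq0 x : (qz x == 0) = (x \is a Num.int).
Proof.
have -> : (0 : QmodZ) = qz 0 by rewrite raddf0.
by rewrite -[x in RHS]subr0; apply/esym/(Quotient.idealrBE intq).
Qed.

Lemma qz_divisible (q : QmodZ) (p : nat) : (0 < p)%N -> exists s : QmodZ, s *+ p = q.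
Proof.
move=> p_gt0; have [x ->] := qz_surj q; exists (qz (x / p%:R)).
by rewrite -raddfMn -(mulr_natr (x / p%:R)) divfK // pnatr_eq0 -lt0n.
Qed.

Lemma qz_inv_eq0 (p : nat) (k : int) : (0 < p)%N ->
  (qz p%:R^-1 *~ k == 0) = (p %| k)%Z.
Proof.
move=> p_gt0; have p0 : p%:R != 0 :> rat by rewrite pnatr_eq0 -lt0n.
rewrite -raddfMz qz_eq0 -mulrzr; apply/intrP/dvdzP => [[m Dm]|[m ->]].
  exists m; apply: (@intr_inj rat); rewrite rmorphM /= -Dm.
  by rewrite mulrAC mulVf // mul1r.
by exists m; rewrite intrM mulrCA mulVf // mulr1.
Qed.

Local Close Scope quotient_scope.

Section Embedding.

Variable G : zmodType.
Hypothesis torsion : forall a : G, exists2 n, (0 < n)%N & a *+ n = 0.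
Hypothesis rank_le1 : forall p (c e : G), prime p -> c != 0 ->
  c *+ p = 0 -> e *+ p = 0 -> exists i, e = c *+ i.

Lemma bezout_nat (A : zmodType) (B : set A) (a : A) (p : nat) (k : int) :
    additive_subgroup B -> prime p -> ~~ (p %| k)%Z ->
  B (a *+ p) -> B (a *~ k) -> B a.
Proof.
move=> [B0 BB] pr_p pk Bap Bak.
have BN x : B x -> B (- x) by move=> Bx; rewrite -sub0r; apply: BB.
have BD x y : B x -> B y -> B (x + y).
  by move=> Bx By; rewrite -[y]opprK; apply: BB => //; apply: BN.
have BMn x n : B x -> B (x *+ n).
  by move=> Bx; elim: n => // n IHn; rewrite mulrS; apply: BD.
have BMz x (m : int) : B x -> B (x *~ m).
  by move=> Bx; case: m => m; [|apply: BN]; apply: BMn.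
have /coprimezP[[u v] /= Duv] : coprimez p k.
  by rewrite coprimezE absz_nat prime_coprime.
rewrite -[a]mulr1z -Duv mulrzDr; apply: BD.
  by rewrite mulrC mulrzA; apply: BMz.
by rewrite mulrC mulrzA; apply: BMz.
Qed.

(** The graphs of the injective homomorphisms from a subgroup of G to Q/Z; a union
    of a chain of graphs is again one. *)
Definition partial_embedding (C : set (G * QmodZ)) : Prop :=
  additive_subgroup C /\ forall a q, C (a, q) -> (a = 0 <-> q = 0).

Lemma maximal_partial_embedding : exists2 C, partial_embedding C &
  forall C', partial_embedding C' -> C `<=` C' -> C' `<=` C.
Proof.
have [F Fp totF|C [PC maxC]] := @Zorn_bigcup (G * QmodZ)%type
    [set C | C = set0 \/ partial_embedding C].
  have [[C0 [FC0 [x0 C0x0]]]|no_ne] := pselect (exists C, F C /\ C !=set0); last first.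
    left; rewrite -subset0 => x [C FC Cx]; apply: no_ne.
    by exists C; split=> //; exists x.
  have pe C x : F C -> C x -> partial_embedding C.
    by move=> /Fp[->|].
  right; split; last by move=> a q [C FC Caq]; have [_] := pe C _ FC Caq; apply.
  split; first by exists C0 => //; have [[]] := pe C0 x0 FC0 C0x0.
  move=> x y [C FC Cx] [D FD Dy].
  have [CD|DC] := totF C D FC FD.
    by exists D => //; have [[_ DB] _] := pe D y FD Dy; apply: DB => //; apply: CD.
  by exists C => //; have [[_ CB] _] := pe C x FC Cx; apply: CB => //; apply: DC.
have PC' : partial_embedding C.
  case: PC => // C0; case: (maxC [set 0]).
    by rewrite C0; split=> // /(_ 0 erefl).
  right; split=> [|a q [-> ->]] //; split=> // x y -> ->; exact: subrr.
exists C => // C' pC' CC'; apply: contrapT => nC'C.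
by apply: (maxC C'); [split | right].
Qed.

(** If a maximal partial embedding is not defined everywhere, then some element a'
    outside its domain B has p a' in B. If B contains an element of order p, then
    it contains all the p-torsion of G, so any extension of the embedding to a'
    is injective. Otherwise a' can be changed by an element of B so that p a' = 0,
    and it may be sent to 1/p. *)
Lemma embedding_QmodZ : isomorphic_to_subgroup G QmodZ.
Proof.
have [C [[C0 CB] Cinj] maxC] := maximal_partial_embedding.
have CN b q : C (b, q) -> C (- b, - q).
  by move=> Cx; have := CB _ _ C0 Cx; rewrite sub0r.
have CD b q b' q' : C (b, q) -> C (b', q') -> C (b + b', q + q').
  move=> Cx Cy; rewrite -[b']opprK -[q']opprK.
  exact: (CB (b, q) (- b', - q') Cx (CN _ _ Cy)).
have CMn b q n : C (b, q) -> C (b *+ n, q *+ n).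
  by move=> Cx; elim: n => // n IHn; rewrite !mulrS; apply: CD.
have CMz b q (m : int) : C (b, q) -> C (b *~ m, q *~ m).
  by move=> Cx; case: m => m; [|apply: CN]; apply: CMn.
pose B : set G := [set a | exists q, C (a, q)].
have Bgroup : additive_subgroup B.
  split=> [|a b [q Caq] [r Cbr]]; first by exists 0.
  by exists (q - r); apply: (CB (a, q) (b, r)).
have ext a s : (forall (k : int) b q, C (b, q) -> (b + a *~ k = 0 <-> q + s *~ k = 0)) ->
    B a.
  move=> exts; pose C' := [set x | exists2 y, C y & exists k : int, x = y + (a, s) *~ k].
  have CC' : C `<=` C' by move=> x Cx; exists x => //; exists 0; rewrite mulr0z addr0.
  exists s; apply: (maxC C' _ CC'); last first.
    by exists 0 => //; exists 1; rewrite add0r mulr1z.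
  split; last first.
    move=> b q [[b0 q0] Cy [k Dbq]].
    have pairMz : (a, s) *~ k = (a *~ k, s *~ k).
      by rewrite (surjective_pairing (_ *~ k)) (raddfMz (@fst _ _)) (raddfMz (@snd _ _)).
    by rewrite pairMz in Dbq; case: Dbq => -> ->; apply: exts.
  split; first exact: CC'.
  move=> _ _ [x Cx [k ->]] [y Cy [l ->]]; exists (x - y); first exact: CB.
  by exists (k - l); rewrite mulrzBr opprD addrACA.
pose f a := xget 0 [set q | C (a, q)].
have fP a : B a -> C (a, f a).
  by case=> q Caq; apply: (@xgetPex _ 0 [set q | C (a, q)]); exists q.
have f_unique a q : C (a, q) -> f a = q.
  move=> Caq; have Cf : C (a, f a) by apply: fP; exists q.
  have := CB _ _ Cf Caq; rewrite /GRing.add /= => /Cinj; rewrite subrr => -[/(_ erefl)/eqP + _].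
  by rewrite subr_eq0 => /eqP.
suff Btot a : B a.
  have fB : zmod_morphism f.
    by move=> a b; apply: f_unique; apply: (CB (a, f a) (b, f b)); apply: fP.
  pose fA : {additive G -> QmodZ} := HB.pack f (GRing.isZmodMorphism.Build G QmodZ f fB).
  exists (range f).
    split=> [|_ _ [a _ <-] [b _ <-]]; first by exists 0; rewrite // (f_unique 0 0).
    by exists (a - b); rewrite // fB.
  exists fA; split=> [a _ | a b _ _ eq_f | q [a _ <-]]; [by exists a | | by exists a].
  apply/eqP; rewrite -subr_eq0; apply/eqP/(Cinj _ (f (a - b)) (fP _ (Btot _))).
  by rewrite fB [f a]eq_f subrr.
have BMn x n : B x -> B (x *+ n).
  have [B0 BB] := Bgroup; move=> Bx; elim: n => // n IHn.
  by rewrite mulrS -[x *+ n]opprK; apply: (BB) => //; rewrite -sub0r; apply: BB.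
have BMz x (m : int) : B x -> B (x *~ m).
  have [B0 BB] := Bgroup; move=> Bx; case: m => m; first exact: BMn.
  by rewrite /intmul -sub0r; apply: BB => //; apply: BMn.
have [//|nBa] := pselect (B a); exfalso.
(* Take the least n with n a in B, a prime factor p of n, and a' = (n / p) a. *)
have [p [a' [pr_p nBa' Bpa']]] : exists p a', [/\ prime p, ~ B a' & B (a' *+ p)].
  have [n0 n0_gt0 an0] := torsion a.
  have exn : exists n, (0 < n)%N && `[< B (a *+ n) >].
    by exists n0; rewrite n0_gt0; apply/asboolP; rewrite an0; case: Bgroup.
  case: (ex_minnP exn) => n /andP[n_gt0 /asboolP Ban] minn.
  have n_gt1 : (1 < n)%N.
    by case: n n_gt0 Ban {minn} => [|[]] // _; rewrite mulr1n.
  have pr_p := pdiv_prime n_gt1; have p_n := pdiv_dvd n.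
  exists (pdiv n), (a *+ (n %/ pdiv n)); split=> //; last by rewrite -mulrnA divnK.
  move=> Bq; have : (n <= n %/ pdiv n)%N.
    apply: minn; rewrite divn_gt0 ?prime_gt0 // dvdn_leq //=; exact/asboolP.
  by rewrite leqNgt ltn_Pdiv ?prime_gt1.
have p_gt0 := prime_gt0 pr_p.
have nB_coprime k : ~~ (p %| k)%Z -> ~ B (a' *~ k).
  by move=> pk Bk; apply: nBa'; apply: bezout_nat Bgroup pr_p pk Bpa' Bk.
have [[c [Bc c0 pc]]|no_c] := pselect (exists c, [/\ B c, c != 0 & c *+ p = 0]).
  have [s Ds] := qz_divisible (f (a' *+ p)) p_gt0.
  (* Any s with p s the image of p a' will do. *)
  apply: nBa'; apply: (ext _ s) => k b q Cbq; have Bb : B b by exists q.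
  have [/dvdzP[m ->]|pk] := boolP (p %| k)%Z.
    rewrite [m * _]mulrC !mulrzA -!pmulrn Ds; apply: Cinj.
    by apply: CD => //; apply: CMz; apply: fP.
  split=> [/eqP|qs0].
    rewrite addr_eq0 => /eqP Db; case: (nB_coprime k pk).
    by rewrite -[_ *~ k]opprK -Db -mulrN1z; apply: BMz.
  exfalso; apply: (nB_coprime k pk).
  have e0 : (b + a' *~ k) *+ p = 0.
    apply/(Cinj _ ((q + s *~ k) *+ p)); last by rewrite qs0 mul0rn.
    rewrite !mulrnDl !pmulrn ![_ *~ k *~ _]mulrzAC -!pmulrn Ds.
    by apply: CD; [apply: CMn | apply: CMz; apply: fP].
  have [i De] := rank_le1 pr_p c0 pc e0.
  rewrite -[a' *~ k](addKr b) De addrC.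
  by have [_ BB] := Bgroup; apply: BB => //; apply: BMn.
have p_free b : B b -> b *+ p = 0 -> b = 0.
  by move=> Bb pb; apply/eqP/negPn/negP => b0; apply: no_c; exists b.
(* Without p-torsion, multiplication by p is bijective on the torsion group B. *)
have [b' Bb' pb'] : exists2 b', B b' & b' *+ p = a' *+ p.
  have [m0 m0_gt0 m0_0] := torsion (a' *+ p).
  have exm : exists m, (0 < m)%N && (a' *+ p *+ m == 0).
    by exists m0; rewrite m0_gt0 m0_0 /=.
  case: (ex_minnP exm) => m /andP[m_gt0 /eqP am] minm.
  have pm : ~~ (p %| m)%N.
    apply/negP => pm; have /(minm _) : (0 < m %/ p)%N && (a' *+ p *+ (m %/ p) == 0).
      rewrite divn_gt0 // dvdn_leq //=; apply/eqP/p_free; first exact: BMn.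
      by rewrite -[LHS]mulrnA divnK.
    by rewrite leqNgt ltn_Pdiv ?prime_gt1.
  have /coprimezP[[u v] /= Duv] : coprimez p m by rewrite coprimezE prime_coprime.
  exists (a' *+ p *~ u); first exact: BMz.
  rewrite -[RHS]mulr1z -Duv mulrzDr [v * _]mulrC (mulrzA _ m) -[_ *~ m]pmulrn am mul0rz.
  by rewrite addr0 mulrzA -pmulrn.
pose a2 := a' - b'.
have pa2 : a2 *+ p = 0 by rewrite mulrnBl pb' subrr.
have p_mulz (A : zmodType) (x : A) (m : int) : x *+ p = 0 -> x *~ (m * p) = 0.
  by move=> px; rewrite mulrC mulrzA -pmulrn px mul0rz.
suff Ba2 : B a2.
  apply: nBa'; rewrite -[a'](subrK b') -/a2 -[b']opprK.
  by have [B0 BB] := Bgroup; apply: (BB) => //; rewrite -sub0r; apply: BB.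
apply: (ext _ (qz p%:R^-1)) => k b q Cbq; have Bb : B b by exists q.
have qz_p : qz p%:R^-1 *+ p = 0.
  by apply/eqP; rewrite pmulrn qz_inv_eq0 // dvdzz.
have [/dvdzP[m ->]|pk] := boolP (p %| k)%Z.
  by rewrite !p_mulz // !addr0; apply: Cinj.
split=> [/eqP|/eqP].
  rewrite addr_eq0 => /eqP Db; case: (nB_coprime k pk).
  have -> : a' *~ k = a2 *~ k + b' *~ k by rewrite -mulrzDl subrK.
  rewrite -[a2 *~ k]opprK -Db addrC; have [_ BB] := Bgroup.
  by apply: BB => //; apply: BMz.
rewrite addr_eq0 => /eqP Dq; exfalso; move/negP: pk; apply.
have pq : q *+ p = 0.
  by rewrite Dq mulNrn pmulrn mulrzAC -pmulrn qz_p mul0rz oppr0.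
have b0 : b = 0.
  by apply: p_free => //; apply/(Cinj _ _ (CMn _ _ p Cbq)).
have q0 : q = 0 by apply/(Cinj _ _ Cbq).
by rewrite -qz_inv_eq0 // -oppr_eq0 -Dq q0.
Qed.

End Embedding.

(** * Prime ideals and integral closedness *)

Section PrimeIdeals.

Variable R : idomainType.

Definition prime_ideal (M : set R) : Prop :=
  [/\ additive_subgroup M, forall r x, M x -> M (r * x), ~ M 1 &
      forall x y, M (x * y) -> M x \/ M y].

(** An ideal that is maximal among the proper ideals containing a is prime. *)
Lemma prime_ideal_exists (a : R) : (forall r, r * a != 1) ->
  exists2 M, prime_ideal M & M a.
Proof.
move=> a_nonunit.
pose ideal (I : set R) :=
  [/\ additive_subgroup I, forall r x, I x -> I (r * x), ~ I 1 & I a].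
have [F Fp totF|M [PM maxM]] := @Zorn_bigcup R [set I | I = set0 \/ ideal I].
  have [[I0 [FI0 [x0 I0x0]]]|no_ne] := pselect (exists I, F I /\ I !=set0); last first.
    left; rewrite -subset0 => x [I FI Ix]; apply: no_ne.
    by exists I; split=> //; exists x.
  have pe I x : F I -> I x -> ideal I by move=> /Fp[->|].
  have [[I00 _] _ _ I0a] := pe I0 x0 FI0 I0x0.
  right; split; [split | | | by exists I0].
  - by exists I0.
  - move=> x y [I FI Ix] [J FJ Jy]; have [IJ|JI] := totF I J FI FJ.
      by exists J => //; have [[_ JB] _ _ _] := pe J y FJ Jy; apply: JB => //; apply: IJ.
    by exists I => //; have [[_ IB] _ _ _] := pe I x FI Ix; apply: IB => //; apply: JI.
  - by move=> r x [I FI Ix]; exists I => //; have [_ IM _ _] := pe I x FI Ix; apply: IM.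
  - by move=> [I FI I1]; have [_ _ + _] := pe I 1 FI I1; apply.
have {PM}[[M0 MB] MM M1 Ma] : ideal M.
  case: PM => // M0; case: (maxM [set x | exists r, x = r * a]).
    rewrite M0; split=> // /(_ 0 _)/=; apply; by exists 0; rewrite mul0r.
  right; split; [split | | | by exists 1; rewrite mul1r].
  - by exists 0; rewrite mul0r.
  - by move=> _ _ [r ->] [s ->]; exists (r - s); rewrite mulrBl.
  - by move=> s _ [r ->]; exists (s * r); rewrite mulrA.
  - by move=> [r /esym/eqP]; apply/negP.
exists M => //; split=> // x y Mxy; have [Mx|nMx] := pselect (M x); [by left | right].
(* The ideal generated by M and x contains 1 by maximality. *)
pose N := [set z | exists2 m, M m & exists r, z = m + r * x].
have MN : M `<=` N by move=> m Mm; exists m => //; exists 0; rewrite mul0r addr0.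
have Nx : N x by exists 0 => //; exists 1; rewrite add0r mul1r.
have [m Mm [r D1]] : N 1.
  apply: contrapT => N1; apply: (maxM N); first by split=> // /(_ x Nx).
  right; split=> //; last exact: MN.
    split=> [|_ _ [m Mm [r ->]] [n Mn [s ->]]]; first exact: MN.
    by exists (m - n); [apply: MB | exists (r - s); rewrite mulrBl opprD addrACA].
  move=> s _ [m Mm [r ->]]; exists (s * m); first exact: MM.
  by exists (s * r); rewrite mulrDr mulrA.
rewrite -[y]mul1r D1 mulrDl mulrC -mulrA -[_ + _]opprK opprD.
have MN' z : M z -> M (- z) by move=> Mz; rewrite -sub0r; apply: MB.
by apply/MN'/MB; [apply/MN'; apply: MM | apply: MM].
Qed.

End PrimeIdeals.

Section Integrality.

Lemma Aint_integral x : x \in Aint <-> integralOver (intr : int -> algC) x.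
Proof.
split=> [|[q mon_q qx0]].
  rewrite unfold_in => /floorpP[q Dq]; exists q; last by rewrite -Dq root_minCpoly.
  have := monicP (minCpoly_monic x).
  rewrite Dq lead_coef_map_inj ?rmorph0 //; last exact: intr_inj.
  by move/eqP; rewrite -[X in _ == X]/(1%:~R) eqr_int -monicE.
apply: root_monic_Aint qx0 _ _; first exact: monic_map.
by apply/polyOverP => i; rewrite coef_map /= intr_int.
Qed.

(** Multiplying f by a power of its leading coefficient c gives a monic equation
    for c u with integral coefficients. *)
Lemma Aint_lead_root (f : {poly algC}) u :
  f \is a polyOver Aint -> (1 < size f)%N -> root f u -> lead_coef f * u \in Aint.
Proof.
move=> /polyOverP Af; case sz_f: (size f) => [|[|n]] // _ /rootP fu0.
pose c := lead_coef f; apply/Aint_integral.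
pose g := \poly_(i < n.+2) (if i == n.+1 then 1 else f`_i * c ^+ (n - i)).
have mon_g : g \is monic.
  by rewrite monicE lead_coef_poly ?eqxx ?oner_neq0.
apply: (integral_root_monic (RtoK := intr) mon_g); last first.
  apply/integral_poly => i; apply/Aint_integral; rewrite coef_poly.
  case: ifP => _; last exact: Aint0.
  case: ifP => _; first exact: Aint1.
  by rewrite rpredM ?rpredX ?Af // Af.
have fu : \sum_(i < n.+2) f`_i * u ^+ i = 0 by rewrite -[RHS]fu0 horner_coef sz_f.
apply/rootP; rewrite horner_poly.
transitivity (c ^+ n * \sum_(i < n.+2) f`_i * u ^+ i); last by rewrite fu mulr0.
rewrite mulr_sumr.
rewrite big_ord_recr [in RHS]big_ord_recr /= eqxx mul1r; congr (_ + _).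
  apply: eq_bigr => i _; rewrite ltn_eqF ?ltn_ord //.
  rewrite -/c exprMn -mulrA [c ^+ (n - i) * _]mulrA -exprD.
  by rewrite subnK -1?ltnS ?ltn_ord // mulrCA.
by rewrite exprMn -/c [c ^+ _.+1]exprSr -mulrA {2}/c /lead_coef sz_f.
Qed.

(** Replacing the two leading terms c X^(m+1) + a X^m of f by (c u + a) X^m keeps
    the root u, lowers the degree, and does not change the values at u of the
    quotients of lower index. *)
Lemma Aint_drop_poly (f : {poly algC}) u k :
  f \is a polyOver Aint -> root f u ->
  (drop_poly k f).[u] \in Aint /\ u * (drop_poly k f).[u] \in Aint.
Proof.
have [n] := ubnP (size f); elim: n => // n IHn in f *; rewrite ltnS => le_fn Af fu0.
have /polyOverP Afi := Af.
have [->|f0] := eqVneq f 0; first by rewrite drop_poly0r horner0 mulr0 Aint0.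
have sz_f : (1 < size f)%N := root_size_gt1 f0 fu0.
pose c := lead_coef f; pose m := (size f).-2.
have Dm : size f = m.+2 by rewrite /m; case: (size f) sz_f => [|[]].
have Acu : c * u \in Aint := Aint_lead_root Af sz_f fu0.
have [lt_km|le_mk] := leqP k m; last first.
  have -> : drop_poly k f = (f`_k)%:P.
    apply/polyP => i; rewrite coef_drop_poly coefC; case: i => [|i] //=.
    by rewrite nth_default // Dm addSn ltnS (leq_trans le_mk) ?leq_addl.
  rewrite hornerC Afi mulrC; split=> //.
  have [->|neq_km] := eqVneq k m.+1; first by move: Acu; rewrite /c /lead_coef Dm.
  by rewrite nth_default ?mul0r ?Aint0 // Dm ltn_neqAle eq_sym neq_km.
pose f' : {poly algC} := f - c%:P * 'X^(m.+1) + (c * u)%:P * 'X^m.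
have sz_f' : (size f' < size f)%N.
  rewrite Dm ltnS; apply/leq_sizeP => i le_mi.
  rewrite !coefD coefN !coefCM !coefXn; have [->|neq_i] := eqVneq i m.+1.
    by rewrite eqn_leq ltnn mulr1 mulr0 addr0 /c /lead_coef Dm subrr.
  rewrite gtn_eqF // !mulr0 subr0 addr0 nth_default // Dm.
  by rewrite ltn_neqAle eq_sym neq_i.
have Af' : f' \is a polyOver Aint.
  by rewrite rpredD ?rpredB ?rpredM ?polyOverC ?rpredX ?polyOverX //= Afi.
have ev_f' : f'.[u] = f.[u].
  by rewrite !hornerD hornerN !hornerM !hornerC !hornerXn exprS mulrA subrK.
have f'u0 : root f' u by rewrite /root ev_f' -/(root f u).
have := IHn f' (leq_trans sz_f' le_fn) Af' f'u0.
suff -> : (drop_poly k f').[u] = (drop_poly k f).[u] by [].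
have -> : drop_poly k f' =
    drop_poly k f - c%:P * 'X^(m.+1 - k) + (c * u)%:P * 'X^(m - k).
  apply/polyP => i; rewrite !(coef_drop_poly, coefD, coefN, coefCM, coefXn).
  have shift l : (k <= l)%N -> (i == l - k)%N = (i + k == l)%N.
    by move=> le_kl; rewrite -(eqn_add2r k) subnK.
  by rewrite !shift // leqW.
rewrite !hornerD hornerN !hornerM !hornerC !hornerXn subSn // exprS.
by rewrite mulrA subrK.
Qed.

(** An integral multiple of the minimal polynomial of u, divided by its content. *)
Lemma primitive_equation u p : prime p ->
  exists2 f : {poly int}, root (map_poly (intr : int -> algC) f) u &
    exists k, ~~ (p %| f`_k)%Z.
Proof.
move=> pr_p; have [q [_ mon_q] dvd_q] := minCpolyP u.
have q0 : q != 0 := monic_neq0 mon_q.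
have [f [a a0 Dq]] := rat_poly_scale q.
have f0 : f != 0 by apply: contraNneq q0 => f0; rewrite Dq f0 rmorph0 scaler0.
have qu0 : root (map_poly ratr q) u by rewrite dvd_q.
exists (zprimitive f).
  move: qu0; suff -> : map_poly ratr q = (a%:~R^-1 * (zcontents f)%:~R) *:
      map_poly (intr : int -> algC) (zprimitive f).
    by rewrite rootZ // mulf_neq0 ?invr_eq0 ?intr_eq0 ?zcontents_eq0.
  apply/polyP => i; rewrite coefZ !coef_map Dq coefZ coef_map /=.
  by rewrite [in LHS](zpolyEprim f) coefZ rmorphM fmorphV !rmorph_int intrM mulrA.
apply: contrapT => no_k.
have : (p %| zcontents (zprimitive f))%Z.
  by rewrite dvdz_contents; apply/polyOverP => k; apply/negPn/negP => pk; apply: no_k; exists k.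
by rewrite zcontents_primitive f0 dvdz1 /= => /eqP p1; rewrite p1 in pr_p.
Qed.

Variables (R : idomainType) (j : {rmorphism R -> algC}).
Hypotheses (j_inj : injective j) (R_closed : integrally_closed R).

(** An integral equation of u over the integers is also one of r / s over R. *)
Lemma integral_quotient u r s :
  u \in Aint -> s != 0 -> u * j s = j r -> exists t, u = j t.
Proof.
move=> /Aint_integral[p mon_p pu0] s0 Du.
have s0' : FracField.tofrac s != 0 by rewrite tofrac_eq0.
have [|t Dt] := R_closed (x := FracField.tofrac r / FracField.tofrac s).
  exists (map_poly intr p); first exact: monic_map.
  apply/rootP; rewrite -map_poly_comp.
  set n := size p.
  have split_expn (K : nzRingType) (a : K) (i : 'I_n) : a ^+ n = a ^+ i * a ^+ (n - i).
    by rewrite -exprD subnKC // ltnW.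
  apply: (mulIf (expf_neq0 n s0')); rewrite mul0r.
  have sz q : (size (map_poly q p) <= n)%N by exact: size_poly.
  rewrite (horner_coef_wide _ (sz _ _)) mulr_suml.
  transitivity (FracField.tofrac (\sum_(i < n) (p`_i)%:~R * r ^+ i * s ^+ (n - i))).
    rewrite rmorph_sum; apply: eq_bigr => i _.
    rewrite coef_map /= expr_div_n !rmorphM !rmorphXn /= rmorph_int -!mulrA.
    by congr (_ * (_ * _)); rewrite (split_expn _ _ i) mulKf ?expf_neq0.
  rewrite (_ : \sum_(i < n) _ = 0) ?rmorph0 //; apply: j_inj.
  rewrite rmorph0 rmorph_sum /=.
  transitivity (j s ^+ n * (map_poly intr p).[u]); last by rewrite (rootP pu0) mulr0.
  rewrite (horner_coef_wide _ (sz _ _)) mulr_sumr; apply: eq_bigr => i _.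
  rewrite coef_map /= !rmorphM !rmorphXn /= rmorph_int -Du exprMn (split_expn _ (j s) i).
  by rewrite [RHS]mulrC !mulrA.
exists t; apply: (mulIf (_ : j s != 0)); first by rewrite -(rmorph0 j) (inj_eq j_inj).
rewrite Du -rmorphM; congr (j _); apply/eqP.
by rewrite -tofrac_eq rmorphM /= -Dt divfK.
Qed.

(** The subrings of the form R :&: L for a subfield L of the fraction field of
    R. *)
Definition saturated_subring (E : set R) : Prop :=
  [/\ E 1, forall x y, E x -> E y -> E (x - y), forall x y, E x -> E y -> E (x * y) &
      forall x y w, E x -> E y -> y != 0 -> w * y = x -> E w].

(** This is the valuation ring property of the localization at M: one of z and z'
    divides the other up to factors outside M. For u = z / z' with primitive
    equation f, write b_i for the quotient of f by X^i, evaluated at u. All b_i and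
    u b_i are in E, and the coefficient f_k, which p does not divide, is
    b_k - u b_(k+1). So b_k or u b_(k+1) is not in M. *)
Lemma valuative (E M : set R) p z z' :
    saturated_subring E -> prime_ideal M -> prime p -> M p%:R -> E z -> E z' ->
  exists b c, [/\ E b, E c, ~ M b \/ ~ M c & b * z = c * z'].
Proof.
move=> [E1 EB EM Esat] [[M0 MB] MM M1 _] pr_p Mp Ez Ez'.
have E0 : E 0 by rewrite -(subrr 1); apply: EB.
have EN x : E x -> E (- x) by move=> Ex; rewrite -sub0r; apply: EB.
have ED x y : E x -> E y -> E (x + y).
  by move=> Ex Ey; rewrite -[y]opprK; apply: EB => //; apply: EN.
have EX x n : E x -> E (x ^+ n).
  by move=> Ex; elim: n => // n IHn; rewrite exprS; apply: EM.
have Enat n : E n%:R by elim: n => // n IHn; rewrite -natr1; apply: ED.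
have Eint (a : int) : E a%:~R by case: a => a; [|apply: EN]; apply: Enat.
have [->|z0'] := eqVneq z' 0; first by exists 0, 1; split=> //; [right | rewrite mul0r mulr0].
pose u := j z / j z'.
have jz0' : j z' != 0 by rewrite -(rmorph0 j) (inj_eq j_inj).
have [f fu0 [k pk]] := primitive_equation u pr_p.
set F := map_poly (intr : int -> algC) f in fu0.
have AF : F \is a polyOver Aint by apply/polyOverP => i; rewrite coef_map Aint_int.
have num i : exists2 y, E y & (drop_poly i F).[u] * j (z' ^+ size f) = j y.
  exists (\sum_(l < size f) (f`_(l + i))%:~R * z ^+ l * z' ^+ (size f - l)).
    elim/big_ind: _ => // l _; apply: (EM); last exact: EX.
    by apply: EM; [apply: Eint | apply: EX].
  have sz_d : (size (drop_poly i F) <= size f)%N.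
    by rewrite size_drop_poly (leq_trans (leq_subr _ _)) // size_poly.
  rewrite (horner_coef_wide _ sz_d) mulr_suml rmorph_sum; apply: eq_bigr => l _.
  rewrite coef_drop_poly coef_map /= !rmorphM !rmorphXn /= rmorph_int -!mulrA.
  congr (_ * _); have -> : j z' ^+ size f = j z' ^+ l * j z' ^+ (size f - l).
    by rewrite -exprD subnKC // ltnW.
  by rewrite mulrA -exprMn divfK.
have quot i : exists2 b, E b & (drop_poly i F).[u] = j b.
  have [y Ey Dy] := num i; have [Ab _] := Aint_drop_poly i AF fu0.
  have z0n : z' ^+ size f != 0 by rewrite expf_neq0.
  have [b Db] := integral_quotient Ab z0n Dy.
  exists b => //; apply: (Esat y (z' ^+ size f)) => //; first exact: EX.
  by apply: j_inj; rewrite rmorphM -Db.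
have quotu i : exists b c, [/\ E b, E c, (drop_poly i F).[u] = j b,
    u * (drop_poly i F).[u] = j c & b * z = c * z'].
  have [b Eb Db] := quot i; have [_ Ac] := Aint_drop_poly i AF fu0.
  have Dbz : u * (drop_poly i F).[u] * j z' = j (b * z).
    by rewrite Db rmorphM mulrC mulrA [j z' * u]mulrC divfK // mulrC.
  have [c Dc] := integral_quotient Ac z0' Dbz.
  have Dcz : c * z' = b * z by apply: j_inj; rewrite rmorphM -Dc.
  by exists b, c; split=> //; apply: (Esat (b * z) z') => //; apply: EM.
have [b [c [Eb Ec Db Dc Dbc]]] := quotu k.
have [b' [c' [Eb' Ec' Db' Dc' Dbc']]] := quotu k.+1.
have [Mb|nMb] := pselect (M b); last by exists b, c; split=> //; left.
have [Mc'|nMc'] := pselect (M c'); last by exists b', c'; split=> //; right.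
have Mk : M (f`_k)%:~R.
  have -> : (f`_k)%:~R = b - c'.
    apply: j_inj; rewrite rmorphB -Db -Dc' rmorph_int -(coef_map (intr : int -> algC)).
    rewrite -/F; have -> : drop_poly k F = (F`_k)%:P + drop_poly k.+1 F * 'X.
      apply/polyP => i; rewrite coefD coefC coefMX !coef_drop_poly.
      by case: i => [|i]; rewrite ?addr0 // add0r addnS.
    by rewrite hornerD hornerC hornerMX mulrC addrK.
  exact: MB.
case: M1; have /coprimezP[[v w] /= Dvw] : coprimez p f`_k.
  by rewrite coprimezE absz_nat prime_coprime.
rewrite -(mulr1z 1) -Dvw intrD !intrM -[X in _ + X]opprK; apply: (MB).
  exact: MM.
by rewrite -sub0r; apply: MB => //; apply: MM.
Qed.

End Integrality.

(** * Divisibility locally at a prime *)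

Section SaturatedSubring.

Variables (R : idomainType) (E : set R).
Hypothesis satE : saturated_subring E.

Lemma sat1 : E 1. Proof. by case: satE. Qed.
Lemma satB x y : E x -> E y -> E (x - y). Proof. by case: satE => _ EB _ _; apply: EB. Qed.
Lemma satM x y : E x -> E y -> E (x * y). Proof. by case: satE => _ _ EM _; apply: EM. Qed.
Lemma sat0 : E 0. Proof. by rewrite -(subrr 1); apply: satB; apply: sat1. Qed.
Lemma satN x : E x -> E (- x).
Proof. by move=> Ex; rewrite -sub0r; apply: satB => //; apply: sat0. Qed.
Lemma satD x y : E x -> E y -> E (x + y).
Proof. by move=> Ex Ey; rewrite -[y]opprK; apply: satB => //; apply: satN. Qed.
Lemma satX x n : E x -> E (x ^+ n).
Proof.
by move=> Ex; elim: n => [|n IHn]; [apply: sat1 | rewrite exprS; apply: satM].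
Qed.
Lemma sat_nat n : E n%:R.
Proof.
by elim: n => [|n IHn]; [apply: sat0 | rewrite -natr1; apply: satD => //; apply: sat1].
Qed.
Lemma sat_int (a : int) : E a%:~R.
Proof. by case: a => a; [|apply: satN]; apply: sat_nat. Qed.
Lemma sat_sum I (r : seq I) (q : pred I) (F : I -> R) :
  (forall i, q i -> E (F i)) -> E (\sum_(i <- r | q i) F i).
Proof. by move=> EF; elim/big_ind: _ => //; [apply: sat0 | apply: satD]. Qed.
Lemma sat_div x y w : E x -> E y -> y != 0 -> w * y = x -> E w.
Proof. by case: satE => _ _ _; apply. Qed.

End SaturatedSubring.

Section PrimeIdealTheory.

Variables (R : idomainType) (M : set R) (p : nat).
Hypotheses (primeM : prime_ideal M) (pr_p : prime p) (Mp : M p%:R).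

Lemma idealB x y : M x -> M y -> M (x - y).
Proof. by case: primeM => [[_ MB] _ _ _]; apply: MB. Qed.
Lemma ideal0 : M 0. Proof. by case: primeM => [[]]. Qed.
Lemma idealN x : M x -> M (- x).
Proof. by move=> Mx; rewrite -sub0r; apply: idealB => //; apply: ideal0. Qed.
Lemma idealD x y : M x -> M y -> M (x + y).
Proof. by move=> Mx My; rewrite -[y]opprK; apply: idealB => //; apply: idealN. Qed.
Lemma idealMl r x : M x -> M (r * x). Proof. by case: primeM => _ MM _ _; apply: MM. Qed.
Lemma idealMr r x : M x -> M (x * r). Proof. by rewrite mulrC; apply: idealMl. Qed.
Lemma ideal_proper : ~ M 1. Proof. by case: primeM. Qed.
Lemma primeP x y : ~ M x -> ~ M y -> ~ M (x * y).
Proof. by case: primeM => _ _ _ MP nMx nMy /MP[]. Qed.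
Lemma primeX x n : ~ M x -> ~ M (x ^+ n).
Proof.
by move=> nMx; elim: n => [|n IHn]; [apply: ideal_proper | rewrite exprS; apply: primeP].
Qed.

Lemma ideal_int (a : int) : M a%:~R <-> (p %| a)%Z.
Proof.
split=> [Ma|/dvdzP[b ->]]; last by rewrite intrM; apply: idealMl.
apply: contrapT => /negP pa; apply: ideal_proper.
have /coprimezP[[v w] /= Dvw] : coprimez p a by rewrite coprimezE absz_nat prime_coprime.
by rewrite -(mulr1z 1) -Dvw intrD !intrM; apply: idealD; apply: idealMl.
Qed.

End PrimeIdealTheory.

Section Uniformizer.

Variables (R : idomainType) (j : {rmorphism R -> algC}).
Hypotheses (j_inj : injective j) (R_closed : integrally_closed R).
Variables (E M : set R) (p : nat).
Hypotheses (satE : saturated_subring E) (primeM : prime_ideal M).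
Hypotheses (pr_p : prime p) (Mp : M p%:R).

(** Divisibility in the localization of E at M. *)
Definition locally_divides (t z : R) : Prop :=
  exists b r, [/\ E b, ~ M b, E r & b * z = t * r].

Lemma locally_divides_refl t : locally_divides t t.
Proof.
exists 1, 1; split; rewrite ?mul1r ?mulr1 //; try exact: sat1.
exact: ideal_proper primeM.
Qed.

Lemma locally_divides_trans t z w :
  locally_divides t z -> locally_divides z w -> locally_divides t w.
Proof.
move=> [b [r [Eb nMb Er Dz]]] [b' [r' [Eb' nMb' Er' Dw]]].
exists (b * b'), (r * r'); split; try exact: satM; first exact: (primeP primeM).
by rewrite -mulrA Dw mulrA Dz -mulrA.
Qed.

Lemma locally_dividesB t z w :
  locally_divides t z -> locally_divides t w -> locally_divides t (z - w).
Proof.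
move=> [b [r [Eb nMb Er Dz]]] [b' [r' [Eb' nMb' Er' Dw]]].
exists (b * b'), (b' * r - b * r'); split; first exact: satM.
- exact: (primeP primeM).
- by apply: (satB satE); apply: satM.
rewrite !mulrBr; congr (_ - _); first by rewrite [b * b']mulrC -mulrA Dz mulrCA.
by rewrite -mulrA Dw mulrCA.
Qed.

Lemma locally_dividesM t z c : E c -> locally_divides t z -> locally_divides t (c * z).
Proof.
move=> Ec [b [r [Eb nMb Er Dz]]]; exists b, (c * r); split=> //; first exact: satM.
by rewrite mulrCA Dz mulrCA.
Qed.

Lemma locally_divides0 t : locally_divides t 0.
Proof. by rewrite -(subrr t); apply: locally_dividesB; apply: locally_divides_refl. Qed.

Lemma locally_divides_total z z' : E z -> E z' ->
  locally_divides z z' \/ locally_divides z' z.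
Proof.
move=> Ez Ez'.
have [b [c [Eb Ec [nMb|nMc] Dbc]]] := valuative j_inj R_closed satE primeM pr_p Mp Ez Ez'.
  by right; exists b, c; split=> //; rewrite Dbc mulrC.
by left; exists c, b; split=> //; rewrite -Dbc mulrC.
Qed.

(** Linear independence over the field with p elements in E / pE. *)
Definition independent_mod n (e : 'I_n -> R) : Prop :=
  forall (a : 'I_n -> int) w, E w -> \sum_i (a i)%:~R * e i = p%:R * w ->
  forall i, (p %| a i)%Z.

Hypothesis finite_rank : exists d, forall n (e : 'I_n -> R),
  (forall i, E (e i)) -> independent_mod e -> (n <= d)%N.

(** Each t in M that locally divides p comes with the elements of E that it
    locally divides. Take t for which these contain a largest family that is
    independent modulo p. An element z of M not locally divisible by t would
    locally divide t, and adjoining z to the family would make it larger. *)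
Lemma uniformizer_exists : exists t, [/\ E t, M t &
  forall z, E z -> M z -> locally_divides t z].
Proof.
have [d rank_d] := finite_rank.
pose good n := exists (t : R) (e : 'I_n -> R), [/\ E t, M t, locally_divides t p%:R,
  forall i, E (e i) /\ locally_divides t (e i) & independent_mod e].
have good0 : exists n, `[< good n >].
  exists 0%N; apply/asboolP; exists p%:R, (fun=> 0); split=> //.
  - exact: sat_nat.
  - exact: locally_divides_refl.
  - by case.
  - by move=> a w _ _ [].
have good_d n : `[< good n >] -> (n <= d)%N.
  by move=> /asboolP[t [e [_ _ _ Ee ind_e]]]; apply: rank_d ind_e => i; case: (Ee i).
case: (ex_maxnP good0 good_d) => n /asboolP[t [e [Et Mt tp te ind_e]]] max_n.
exists t; split=> // z Ez Mz; apply: contrapT => ntz.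
have zt : locally_divides z t by case: (locally_divides_total Et Ez).
suff: good n.+1 by move/asboolP/max_n; rewrite ltnn.
exists z, (fun i => if unlift ord_max i is Some k then e k else z); split=> //.
- exact: locally_divides_trans zt tp.
- move=> i; case: unliftP => [k|] _; last by split=> //; apply: locally_divides_refl.
  by have [Eek tek] := te k; split=> //; apply: locally_divides_trans zt tek.
move=> a w Ew; rewrite big_ord_recr /= unlift_none => Dw.
have Dsum : \sum_(i < n) (a (widen_ord (leqnSn n) i))%:~R *
    (if unlift ord_max (widen_ord (leqnSn n) i) is Some k then e k else z) =
    \sum_(i < n) (a (widen_ord (leqnSn n) i))%:~R * e i.
  apply: eq_bigr => i _; have -> : widen_ord (leqnSn n) i = lift ord_max i.
    by apply: val_inj; rewrite /= /bump leqNgt ltn_ord.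
  by rewrite liftK.
rewrite {}Dsum in Dw; set sum := \sum_(i < n) _ in Dw.
have pa : (p %| a ord_max)%Z.
  apply: contrapT => npa; apply: ntz.
  have : locally_divides t ((a ord_max)%:~R * z).
    have -> : (a ord_max)%:~R * z = w * p%:R - sum by rewrite [w * _]mulrC -Dw addrAC subrr add0r.
    apply: locally_dividesB; first exact: locally_dividesM.
    rewrite /sum; elim/big_ind: _ => [|x y tx ty|i _]; first exact: locally_divides0.
      rewrite -[y]opprK; apply: locally_dividesB => //; rewrite -sub0r.
      by apply: locally_dividesB => //; apply: locally_divides0.
    by apply: locally_dividesM; [apply: sat_int | case: (te i)].
  move=> [b [r [Eb nMb Er Dbz]]]; exists (b * (a ord_max)%:~R), r; split=> //.
  - by apply: satM => //; apply: sat_int.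
  - by apply: (primeP primeM) => // /(ideal_int primeM pr_p Mp).
  by rewrite -mulrA.
have /dvdzP[a' Da'] := pa.
have Ewz : E (w - a'%:~R * z) by apply: satB => //; apply: satM => //; apply: sat_int.
have Dsum : sum = p%:R * (w - a'%:~R * z).
  by rewrite mulrBr -Dw Da' intrM [_ * p%:~R]mulrC -mulrA addrK.
move=> i; have [k ->|->//] := unliftP ord_max i.
have -> : lift ord_max k = widen_ord (leqnSn n) k.
  by apply: val_inj; rewrite /= /bump leqNgt ltn_ord.
exact: (ind_e (fun k => a (widen_ord (leqnSn n) k)) _ Ewz Dsum).
Qed.

End Uniformizer.

(** * The Frobenius map modulo a prime *)

Section ResidueFields.

Variables (R : idomainType) (j : {rmorphism R -> algC}).
Hypotheses (j_inj : injective j) (j_int : forall x, j x \in Aint).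
Variables (M : set R) (p : nat).
Hypotheses (primeM : prime_ideal M) (pr_p : prime p) (Mp : M p%:R).

(** The binomial coefficients in the middle are divisible by p. *)
Lemma frobeniusD (E : set R) a b : saturated_subring E -> E a -> E b ->
  exists2 w, E w & (a + b) ^+ p = a ^+ p + b ^+ p + p%:R * w.
Proof.
move=> satE Ea Eb; have p_gt0 := prime_gt0 pr_p.
exists (\sum_(1 <= i < p) (a ^+ (p - i) * b ^+ i) *+ ('C(p, i) %/ p)).
  apply: sat_sum => // i _; rewrite -mulr_natr; apply: (satM satE).
    by apply: (satM satE); apply: (satX satE).
  exact: sat_nat.
rewrite exprDn -(big_mkord xpredT (fun i => a ^+ (p - i) * b ^+ i *+ 'C(p, i))).
rewrite big_ltn // big_nat_recr //= subn0 subnn bin0 binn !expr0 mulr1 mul1r !mulr1n.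
rewrite [in LHS](addrC _ (b ^+ p)) addrA; congr (_ + _).
rewrite mulr_sumr; apply: eq_big_nat => i ip.
by rewrite mulr_natl -mulrnA divnK // prime_dvd_bin.
Qed.

Lemma prime_expr x n : M (x ^+ n) -> M x.
Proof. by move=> Mxn; apply: contrapT => nMx; exact: (primeX primeM nMx Mxn). Qed.

(** The Frobenius map of the domain R / M is injective. *)
Lemma prime_frobenius_inj a b : M (a ^+ p - b ^+ p) -> M (a - b).
Proof.
move=> Mab; apply: (@prime_expr _ p).
have satT : saturated_subring [set: R] by [].
have [w _ Dw] := @frobeniusD _ (a - b) b satT I I.
have -> : (a - b) ^+ p = a ^+ p - b ^+ p - p%:R * w.
  by rewrite -[in RHS](subrK b a) Dw addrAC addrK addrK.
by apply: (idealB primeM) => //; apply: (idealMr primeM).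
Qed.

(** Modulo M, every power of z is a combination of a fixed number of them, with
    coefficients in a finite field. *)
Lemma finite_residues (z : R) : exists n, forall k, exists a : {ffun 'I_n -> 'I_p.-1.+1},
  M (z ^+ k - \sum_(i < n) (a i)%:R * z ^+ i).
Proof.
have [->|z0] := eqVneq z 0.
  exists 1%N => k; exists [ffun=> inord (k == 0%N)].
  rewrite big_ord1 ffunE inordK; last first.
    by rewrite prednK ?prime_gt0 // (leq_ltn_trans (leq_b1 _)) ?prime_gt1.
  by rewrite expr0 mulr1 expr0n; case: (k == 0%N); rewrite subrr; apply: ideal0.
have [f [mon_f _ _ fz0]] := integral_equation j_inj j_int z0.
exists (size f) => k; pose r := Pdiv.Ring.rmodp 'X^k f.
exists [ffun i : 'I_(size f) => inord `|(r`_i %% p)%Z|%N].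
have evalE (h : {poly int}) : (size h <= size f)%N ->
    (map_poly intr h).[z] = \sum_(i < size f) (h`_i)%:~R * z ^+ i.
  move=> szh; rewrite (@horner_coef_wide _ (size f)) ?(leq_trans (size_poly _ _)) //.
  by apply: eq_bigr => i _; rewrite coef_map.
have -> : z ^+ k = \sum_(i < size f) (r`_i)%:~R * z ^+ i.
  rewrite -evalE; last by rewrite ltnW // Pdiv.Ring.ltn_rmodpN0 // monic_neq0.
  rewrite -[LHS]hornerXn -(map_polyXn intr).
  rewrite {1}(Pdiv.RingMonic.rdivp_eq mon_f 'X^k) rmorphD rmorphM hornerD hornerM /=.
  by rewrite (evalE f) // fz0 mulr0 add0r.
rewrite -sumrB; elim/big_ind: _ => [|x y|i _]; [exact: ideal0 | exact: idealD | ].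
rewrite ffunE inordK -?mulrBl; last first.
  rewrite prednK ?prime_gt0 // -ltz_nat gez0_abs ?modz_ge0 ?ltz_pmod //.
    by rewrite ltz_nat prime_gt0.
  by rewrite eqz_nat -lt0n prime_gt0.
apply: (idealMr primeM); rewrite -[X in _ - X]/(((`|(r`_i %% p)%Z|%N)%:Z)%:~R).
rewrite gez0_abs ?modz_ge0 ?eqz_nat -?lt0n ?prime_gt0 //.
rewrite {1}(divz_eq r`_i p) intrD addrK intrM.
exact: (idealMl primeM).
Qed.

(** By the pigeonhole principle two iterates of Frobenius agree at z modulo M, and
    Frobenius is injective modulo M. *)
Lemma prime_fixed_power z : exists m, M (z - z ^+ (p ^ m.+1)).
Proof.
have [n res] := finite_residues z.
have [a Da] := choice res.
pose phi (i : 'I_(#|{ffun 'I_n -> 'I_p.-1.+1}|.+1)) := a (p ^ i)%N.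
have /injectivePn[i [k neq_ik eq_ik]] : ~~ injectiveb phi.
  apply/negP => /injectiveP/leq_card; rewrite card_ord ltnn.
  by [].
wlog lt_ik : i k neq_ik eq_ik / (i < k)%N.
  move=> IH; have [lt|lt|/val_inj eq] := ltngtP i k; first exact: (IH i k).
    by apply: (IH k i); rewrite // eq_sym.
  by rewrite eq eqxx in neq_ik.
exists (k - i).-1; rewrite prednK ?subn_gt0 //.
have : M (z ^+ (p ^ i) - z ^+ (p ^ k)).
  rewrite -[z ^+ (p ^ i)](subrK (\sum_(l < n) (a (p ^ i)%N l)%:R * z ^+ l)) -addrA.
  apply: (idealD primeM); first exact: Da.
  rewrite -[X in M X]opprK opprB; apply: (idealN primeM).
  by move: eq_ik; rewrite /phi => ->; apply: Da.
rewrite -{1}(subnKC (ltnW lt_ik)); move: (k - i)%N => m.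
elim: (i : nat) => [|l IHl]; first by rewrite expn0 expr1 add0n.
by rewrite addSn !expnSr !exprM => /prime_frobenius_inj.
Qed.

End ResidueFields.

(** * The p-torsion of a grading group *)

Section RankOneCore.

Variables (R : idomainType) (j : {rmorphism R -> algC}).
Hypotheses (j_inj : injective j) (j_int : forall x, j x \in Aint).
Hypothesis R_closed : integrally_closed R.
Variables (G : zmodType) (P : G -> set R).
Hypothesis gP : is_grading P.
Variables (E M : set R) (p : nat).
Hypotheses (satE : saturated_subring E) (primeM : prime_ideal M).
Hypotheses (pr_p : prime p) (Mp : M p%:R).
Hypothesis E_component : forall z g, E z -> E (component P g z).
Hypothesis E_torsion : forall z g, E z -> component P g z != 0 -> g *+ p = 0.
Hypothesis finite_rank : exists d, forall n (e : 'I_n -> R),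
  (forall i, E (e i)) -> independent_mod E p e -> (n <= d)%N.

Let E0 : set R := [set z | E z /\ P 0 z].

Lemma nat_neq0 n : (0 < n)%N -> n%:R != 0 :> R.
Proof. by move=> n_gt0; rewrite -(j_eq0 j_inj) rmorph_nat pnatr_eq0 -lt0n. Qed.

Lemma degree0_cancel g w z : P 0 z -> z != 0 -> P g (z * w) -> P g w.
Proof.
move=> Pz z0 Pzw; apply/(hom_component gP); apply: (mulfI z0).
by rewrite -(component0M gP) //; apply/(hom_component gP).
Qed.

Lemma sat_E0 : saturated_subring E0.
Proof.
split.
- by split; [apply: sat1 satE | apply: hom1 gP].
- by move=> x y [Ex Px] [Ey Py]; split; [apply: (satB satE) | apply: (homB gP)].
- by move=> x y [Ex Px] [Ey Py]; split; [apply: (satM satE) | apply: (hom0M gP)].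
move=> x y w [Ex Px] [Ey Py] y0 Dx; split; first exact: (sat_div satE Ex Ey y0 Dx).
by apply: (degree0_cancel Py y0); rewrite mulrC Dx.
Qed.

Lemma finite_rank_E0 : exists d, forall n (e : 'I_n -> R),
  (forall i, E0 (e i)) -> independent_mod E0 p e -> (n <= d)%N.
Proof.
have [d rank_d] := finite_rank; exists d => n e E0e ind_e.
apply: (rank_d n e) => [i|a w Ew Dw]; first exact: (E0e i).1.
apply: (ind_e a w _ Dw); split=> //.
apply: (degree0_cancel (hom_nat gP p) (nat_neq0 (prime_gt0 pr_p))).
rewrite -Dw; apply: (hom_sum gP) => i _; apply: (hom0M gP); first exact: hom_int.
exact: (E0e i).2.
Qed.

(** Modulo p, Frobenius is additive, and it sends every component of z to degree
    zero, since all degrees in E are killed by p. *)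
Lemma frobenius_degree0 z : E z ->
  exists c w, [/\ E0 c, E w & z ^+ p = c + p%:R * w].
Proof.
move=> Ez; rewrite -(sum_components gP z).
elim: (X in \sum_(i <- X) _ ) => [|g s [c [w [E0c Ew Dcw]]]].
  exists 0, 0; split; [exact: sat0 sat_E0 | exact: sat0 satE |].
  by rewrite big_nil expr0n mulr0 addr0 eqn0Ngt prime_gt0.
rewrite big_cons; set y := component P g z; set b := \sum_(i <- s) _ in Dcw *.
have Ey : E y := E_component g Ez.
have Eb : E b by apply: (sat_sum satE) => i _; apply: E_component.
have [w' Ew' ->] := frobeniusD pr_p satE Ey Eb.
exists (y ^+ p + c), (w + w'); split; first apply: (satD sat_E0) => //.
- split; first exact: (satX satE).
  have [->|y0] := eqVneq y 0; first by rewrite expr0n eqn0Ngt prime_gt0 //; apply: hom0 gP _.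
  by rewrite -(E_torsion Ez y0); apply: (homX gP); apply: componentP gP _ _.
- exact: (satD satE).
by rewrite Dcw mulrDr !addrA.
Qed.

(** E and its degree-zero part have the same residue field at M: modulo M, z is a
    p-th power of another power of z, hence of degree zero. *)
Lemma residue_degree0 z : E z -> exists c m, [/\ E0 c, E m, M m & z = c + m].
Proof.
move=> Ez; have [n Mz] := prime_fixed_power j_inj j_int primeM pr_p Mp z.
have [c [w [E0c Ew Dcw]]] := frobenius_degree0 (satX satE (p ^ n) Ez).
exists c, (z - c); split=> //; last by rewrite addrC subrK.
  by apply: (satB satE) => //; case: E0c.
rewrite expnSr exprM Dcw opprD addrA in Mz.
by rewrite -[z - c](subrK (p%:R * w)); apply: (idealD primeM) => //; apply: (idealMr primeM).
Qed.

Lemma E0_sub z : E0 z -> E z. Proof. by case. Qed.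

Variables t u : R.
Hypotheses (Et : E t) (Mt : M t) (E0u : E0 u) (Mu : M u).
Hypothesis t_min : forall z, E z -> M z -> locally_divides E M t z.
Hypothesis u_min : forall z, E0 z -> M z -> locally_divides E0 M u z.

(** The expansion of z in powers of the uniformizer t, with coefficients of degree
    zero. The denominator s is of degree zero too, because a denominator b outside
    M may be replaced by the degree-zero part of b^p modulo p. *)
Lemma local_expansion n z : E z -> exists (s : R) (c : nat -> R) (r w : R),
  [/\ E0 s /\ ~ M s, forall i, E0 (c i), E r, E w &
      s * z = \sum_(i < n) c i * t ^+ i + t ^+ n * r + p%:R * w].
Proof.
move=> Ez; elim: n => [|n [s [c [r [w [[E0s nMs] E0c Er Ew Dz]]]]]].
  exists 1, (fun=> 0), z, 0; split=> //.
  - by split; [apply: sat1 sat_E0 | apply: ideal_proper primeM].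
  - by move=> _; apply: sat0 sat_E0.
  - exact: sat0 satE.
  by rewrite big_ord0 expr0 !mul1r mulr0 add0r addr0.
have [c0 [m [E0c0 Em Mm Dr]]] := residue_degree0 Er.
have [b [r' [Eb nMb Er' Dm]]] := t_min Em Mm.
have [b0 [w' [E0b0 Ew' Db]]] := frobenius_degree0 Eb.
(* The element b^p is outside M and congruent to b0 modulo p. *)
have nMb0 : ~ M b0.
  move=> Mb0; apply: (primeX primeM (n := p) nMb); rewrite Db.
  by apply: (idealD primeM) => //; apply: (idealMr primeM).
have Db0m : b0 * m = t * (b ^+ p.-1 * r') - p%:R * (w' * m).
  apply/eqP; rewrite -subr_eq opprK mulrA -mulrDl -Db; apply/eqP.
  by rewrite -{1}(prednK (prime_gt0 pr_p)) exprSr -mulrA Dm mulrCA.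
exists (b0 * s), (fun i => if i == n then b0 * c0 else b0 * c i).
exists (b ^+ p.-1 * r'), (b0 * w - t ^+ n * (w' * m)); split.
- by split; [apply: (satM sat_E0) | apply: (primeP primeM)].
- by move=> i; case: ifP => _; apply: (satM sat_E0).
- by apply: (satM satE) => //; apply: (satX satE).
- apply: (satB satE); first by apply: (satM satE) => //; apply: E0_sub.
  by apply: (satM satE); [apply: (satX satE) | apply: (satM satE)].
rewrite big_ord_recr /= eqxx -mulrA Dz Dr !mulrDr mulr_sumr.
have -> : \sum_(i < n) (if i == n :> nat then b0 * c0 else b0 * c i) * t ^+ i =
          \sum_(i < n) b0 * (c i * t ^+ i).
  by apply: eq_bigr => i _; rewrite ltn_eqF // mulrA.
have -> : b0 * (t ^+ n * m) = t ^+ n.+1 * (b ^+ p.-1 * r') - p%:R * (t ^+ n * (w' * m)).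
  rewrite mulrCA Db0m mulrBr exprSr !mulrA; congr (_ - _).
  by rewrite -!mulrA mulrCA.
rewrite -!addrA; congr (_ + _).
rewrite [b0 * (t ^+ n * c0)]mulrCA [t ^+ n * (b0 * c0)]mulrC; congr (_ + (_ + _)).
by rewrite mulrN addrC [b0 * (p%:R * w)]mulrCA.
Qed.

(** Both p and the degree-zero part of t^p modulo p lie in the degree-zero part of
    M, so they are locally divisible by u. *)
Lemma local_span z : E z -> exists (s : R) (c : nat -> R) (r : R),
  [/\ E0 s /\ ~ M s, forall i, E0 (c i), E r &
      s * z = \sum_(i < p) c i * t ^+ i + u * r].
Proof.
move=> Ez; have [s [c [r [w [[E0s nMs] E0c Er Ew Dz]]]]] := local_expansion p Ez.
have [v [w' [E0v Ew' Dtp]]] := frobenius_degree0 Et.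
have Mv : M v.
  have -> : v = t ^+ p - p%:R * w' by rewrite Dtp addrK.
  apply: (idealB primeM); last exact: (idealMr primeM).
  by rewrite -(prednK (prime_gt0 pr_p)) exprS; apply: (idealMr primeM).
have [b [rv [E0b nMb E0rv Dv]]] := u_min E0v Mv.
have [b' [rp [E0b' nMb' E0rp Dp]]] := u_min (sat_nat sat_E0 p) Mp.
have [Eb Eb' Erv Erp] : [/\ E b, E b', E rv & E rp] by split; apply: E0_sub.
exists (b * b' * s), (fun i => b * b' * c i), (b' * rv * r + b * rp * (w' * r) + b * rp * w).
split.
- split; first by do 2!apply: (satM sat_E0) => //.
  by do 2!apply: (primeP primeM) => //.
- by move=> i; do 2!apply: (satM sat_E0) => //.
- by do ?[apply: (satD satE) | apply: (satM satE)].
rewrite -mulrA Dz Dtp mulrDl.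
have -> : \sum_(i < p) b * b' * c i * t ^+ i = b * b' * \sum_(i < p) c i * t ^+ i.
  by rewrite mulr_sumr; apply: eq_bigr => i _; rewrite mulrA.
rewrite !mulrDr -!addrA; congr (_ + (_ + (_ + _))).
- by rewrite mulrACA Dv; ring.
- by transitivity (b * (b' * p%:R) * (w' * r)); [ring | rewrite Dp; ring].
by transitivity (b * (b' * p%:R) * w); [ring | rewrite Dp; ring].
Qed.

Lemma u_neq0 : u != 0.
Proof.
have [b [r [_ nMb _ Dp]]] := u_min (sat_nat sat_E0 p) Mp.
apply/eqP => u0; move/eqP: Dp; rewrite u0 mul0r mulf_eq0.
rewrite (negPf (nat_neq0 (prime_gt0 pr_p))) orbF => /eqP b0.
by apply: nMb; rewrite b0; apply: ideal0 primeM.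
Qed.

(** A power of u is locally divisible by p. In a primitive equation of u, the
    terms below the first coefficient prime to p are divisible by p. *)
Lemma uniformizer_power : exists (e : nat) (c w : R),
  ~ M c /\ c * u ^+ e = p%:R * w.
Proof.
have [f fu0 [k0 pk0]] := primitive_equation (j u) pr_p.
have ex_k : exists k, ~~ (p %| f`_k)%Z by exists k0.
case: (ex_minnP ex_k) => k pk min_k.
pose F := map_poly (intr : int -> R) f.
have Fu0 : F.[u] = 0.
  apply: j_inj; rewrite rmorph0 -horner_map -map_poly_comp.
  by rewrite -(rootP fu0); congr (_.[_]); apply: eq_map_poly => a /=; rewrite rmorph_int.
have [w Dw] : exists w, (take_poly k F).[u] = p%:R * w.
  exists (\sum_(i < k) (f`_i %/ p)%Z%:~R * u ^+ i).
  rewrite (@horner_coef_wide _ k) ?size_take_poly // mulr_sumr.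
  apply: eq_bigr => i _; rewrite coef_take_poly ltn_ord coef_map /= mulrA.
  congr (_ * _); have pf : (p %| f`_i)%Z.
    by apply: contraLR (ltn_ord i) => /min_k; rewrite -leqNgt.
  by rewrite -{1}(divzK pf) intrM mulrC.
exists k, (drop_poly k F).[u], (- w); split.
  have -> : drop_poly k F = (F`_k)%:P + drop_poly k.+1 F * 'X.
    apply/polyP => i; rewrite coefD coefC coefMX !coef_drop_poly.
    by case: i => [|i]; rewrite ?addr0 // add0r addnS.
  rewrite hornerD hornerC hornerMX => Mc; move/negP: pk; apply.
  apply/(ideal_int primeM pr_p Mp); rewrite -(coef_map (intr : int -> R)) -/F.
  by rewrite -[F`_k](addrK ((drop_poly k.+1 F).[u] * u)); apply: (idealB primeM) => //;
     apply: (idealMl primeM).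
apply/eqP; rewrite mulrN -addr_eq0 addrC -Dw -Fu0 -{3}(poly_take_drop k F).
by rewrite hornerD hornerM hornerXn.
Qed.

Lemma integer_multiple x : x != 0 -> exists2 N : int, N != 0 & exists w : R, w * x = N%:~R.
Proof.
move=> x0; have [f [mon_f szf f0 fx0]] := integral_equation j_inj j_int x0.
exists (- f`_0); first by rewrite oppr_eq0.
move: fx0; case: (size f) szf => [|n] szf.
  by have := size_minCpoly (j x); rewrite -szf.
rewrite big_ord_recl expr0 mulr1 => /eqP; rewrite addrC addr_eq0 => /eqP fx.
exists (\sum_(i < n) (f`_i.+1)%:~R * x ^+ i); rewrite rmorphN /= -fx mulr_suml.
by apply: eq_bigr => i _; rewrite -mulrA -exprSr.
Qed.

(** An integer in M is divisible by p, so the factors p are split off one by one. *)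
Lemma local_dvd_int a (N : int) s r :
  ~ M s -> s * N%:~R = p%:R ^+ a * r -> ((p ^ a)%N %| N)%Z.
Proof.
move=> nMs; elim: a N r => [|a IHa] N r; first by rewrite dvd1z.
rewrite exprS -mulrA => Dr.
have MN : M N%:~R.
  apply: contrapT => nMN; apply: (primeP primeM nMs nMN); rewrite Dr.
  exact: (idealMr primeM).
have /dvdzP[N' DN] : (p %| N)%Z by apply/(ideal_int primeM pr_p Mp).
rewrite DN expnSr PoszM dvdz_mul // (IHa _ r) //.
apply: (mulfI (nat_neq0 (prime_gt0 pr_p))); rewrite -Dr DN intrM.
by rewrite mulrC -mulrA.
Qed.

(** Since x divides a nonzero integer and p divides a power of u, a high power of
    u dividing x would lead to a high power of p dividing that integer. *)
Lemma uniformizer_exponent_bound x : x != 0 -> exists B : nat, forall n s r,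
  ~ M s -> s * x = u ^+ n * r -> (n <= B)%N.
Proof.
move=> x0; have [N N0 [w Dw]] := integer_multiple x0.
(* A bound a on the p-adic valuation of N is enough, so take the absolute value of N. *)
have [e [c [v [nMc Dc]]]] := uniformizer_power.
pose a := `|N|%N; exists (e * a)%N => n s r nMs Dx.
rewrite leqNgt; apply/negP => /ltnW/subnKC Dn.
have : ((p ^ a)%N %| N)%Z.
  apply: (@local_dvd_int a N (c ^+ a * s) (v ^+ a * u ^+ (n - e * a) * r * w)).
    by apply: (primeP primeM) => //; apply: (primeX primeM).
  rewrite -Dw; transitivity (c ^+ a * (s * x) * w); first by ring.
  rewrite Dx -Dn addKn exprD exprM.
  transitivity ((c * u ^+ e) ^+ a * u ^+ (n - e * a) * r * w).
    by rewrite exprMn; ring.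
  by rewrite Dc exprMn; ring.
rewrite dvdzE absz_nat => /dvdn_leq; rewrite absz_gt0 => /(_ N0).
rewrite leqNgt; move/negP; apply.
by rewrite -/a ltn_expl ?prime_gt1.
Qed.

(** Divide x locally by the largest possible power of u. *)
Lemma minimal_multiple g x : E x -> P g x -> x != 0 ->
  exists x', [/\ E x', P g x' & forall s r, E0 s -> E r -> s * x' = u * r -> M s].
Proof.
move=> Ex Px x0; have [B leB] := uniformizer_exponent_bound x0.
pose D n := exists s r, [/\ E0 s, ~ M s, E r & s * x = u ^+ n * r].
have exD : exists n, `[< D n >].
  exists 0%N; apply/asboolP; exists 1, x; split=> //; first exact: sat1 sat_E0.
  exact: ideal_proper primeM.
have D_leB n : `[< D n >] -> (n <= B)%N.
  by move=> /asboolP[s [r [_ nMs _ Dx]]]; apply: leB nMs Dx.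
case: (ex_maxnP exD D_leB) => n /asboolP[s [x' [E0s nMs Ex' Dx']]] max_n.
exists x'; split=> //.
  apply: (@degree0_cancel g x' (u ^+ n)).
  - by case: (satX sat_E0 n E0u).
  - by rewrite expf_neq0 ?u_neq0.
  by rewrite -Dx'; apply: (hom0M gP) => //; case: E0s.
move=> s' r E0s' Er Dr; apply: contrapT => nMs'.
have : D n.+1.
  exists (s' * s), r; split=> //; [exact: (satM sat_E0) | exact: (primeP primeM) |].
  by rewrite -mulrA Dx' mulrCA Dr exprSr mulrA.
by move/asboolP/max_n; rewrite ltnn.
Qed.

(** Local divisibility is a total preorder. *)
Lemma local_pivot n (y : 'I_n.+1 -> R) : (forall k, E0 (y k)) ->
  exists l, forall k, locally_divides E0 M (y l) (y k).
Proof.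
elim: n y => [|n IHn] y E0y.
  exists ord0 => k; rewrite (ord1 k).
  exact: (locally_divides_refl sat_E0 primeM).
have [l min_l] := IHn (fun k => y (lift ord_max k)) (fun k => E0y _).
have [le_l|le_max] := locally_divides_total j_inj R_closed sat_E0 primeM pr_p Mp
    (E0y (lift ord_max l)) (E0y ord_max).
  by exists (lift ord_max l) => k; case: (unliftP ord_max k) => [k'|] ->.
exists ord_max => k; case: (unliftP ord_max k) => [k'|] ->; last first.
  exact: (locally_divides_refl sat_E0 primeM).
exact: (locally_divides_trans sat_E0 primeM le_max).
Qed.

(** Gaussian elimination, where the pivot locally divides all entries of the last
    column, so that one of the coefficients remains outside M. *)
Lemma local_relation n (v : 'I_n.+1 -> nat -> R) : (forall k i, E0 (v k i)) ->
  exists q : 'I_n.+1 -> R, [/\ forall k, E0 (q k), exists k, ~ M (q k) &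
    forall i, (i < n)%N -> \sum_k q k * v k i = 0].
Proof.
elim: n v => [|n IHn] v E0v.
  exists (fun=> 1); split=> //; first by move=> _; apply: sat1 sat_E0.
  by exists ord0; apply: ideal_proper primeM.
have [l min_l] := local_pivot (fun k => E0v k n).
have /choice[b /choice[r br]] : forall k, exists b r, [/\ E0 b, ~ M b, E0 r &
    b * v (lift l k) n = v l n * r] by move=> k; apply: min_l.
have E0b k : E0 (b k) by case: (br k).
have E0r k : E0 (r k) by case: (br k).
pose v' k i := b k * v (lift l k) i - r k * v l i.
have [|q [E0q [k0 nMq] Dq]] := IHn v'.
  by move=> k i; apply: (satB sat_E0); apply: (satM sat_E0).
exists (fun k => if unlift l k is Some k' then q k' * b k' else - \sum_k q k * r k).
split=> [k||i lt_in].
- case: unliftP => [k'|] _; first exact: (satM sat_E0).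
  by apply: (satN sat_E0); apply: (sat_sum sat_E0) => k' _; apply: (satM sat_E0).
- by exists (lift l k0); rewrite liftK; apply: (primeP primeM) => //; case: (br k0).
rewrite (bigD1_ord l) //= unlift_none mulNr mulr_suml addrC.
apply/eqP; rewrite subr_eq0 -subr_eq0 -sumrB; apply/eqP.
transitivity (\sum_k q k * v' k i).
  by apply: eq_bigr => k _; rewrite liftK /v' mulrBr !mulrA.
move: lt_in; rewrite ltnS leq_eqVlt => /predU1P[->|/Dq //].
rewrite big1 // => k _; rewrite /v'; have [_ _ _ ->] := br k.
by rewrite mulrC [r k * _]mulrC subrr mul0r.
Qed.

(** By [local_span], the minimal multiples of 1, x, ..., x^(p-1), y are combinations
    of the p elements t^i modulo u, so there is a relation between them modulo u
    with a coefficient outside M. Its homogeneous components contradict minimality,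
    as the p + 1 degrees are distinct. *)
Theorem rank_one_core g h x y : E x -> E y -> P g x -> P h y -> x != 0 -> y != 0 ->
  g != 0 -> (forall i, h <> g *+ i) -> False.
Proof.
move=> Ex Ey Px Py x0 y0 g0 h_notin.
have pg : g *+ p = 0 by apply: (E_torsion Ex); rewrite (component_hom gP _ Px) eqxx.
(* The index p stands for y, and an index k < p for x^k. *)
pose deg (k : 'I_p.+1) := if k == p :> nat then h else g *+ k.
have gX_inj a b : (a < b)%N -> (b < p)%N -> g *+ a <> g *+ b.
  move=> lt_ab lt_bp eq_ab; case/eqP: g0.
  have gba : g *+ (b - a) = 0 by rewrite mulrnBr ?(ltnW lt_ab) // eq_ab subrr.
  have /coprimezP[[m m'] /= Dmm] : coprimez p (b - a)%N.
    rewrite coprimezE prime_coprime //; apply/negP => /dvdn_leq.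
    by rewrite subn_gt0 => /(_ lt_ab); rewrite leqNgt (leq_ltn_trans (leq_subr _ _)).
  by rewrite -[g]mulr1z -Dmm mulrzDr [m * _]mulrC [m' * _]mulrC !mulrzA -!pmulrn pg gba
     !mul0rz addr0.
have deg_inj : injective deg.
  move=> k l; rewrite /deg; case: eqP => [Dk|/eqP nk]; case: eqP => [Dl|/eqP nl].
  - by move=> _; apply: val_inj; rewrite /= Dk Dl.
  - by move/h_notin.
  - by move/esym/h_notin.
  have lt_p (i : 'I_p.+1) : i != p :> nat -> (i < p)%N.
    by rewrite ltn_neqAle -ltnS ltn_ord andbT.
  move=> eq_kl; apply: val_inj => /=; case: (ltngtP k l) => // lt_kl.
    by case: (gX_inj k l lt_kl (lt_p l nl)).
  by case: (gX_inj l k lt_kl (lt_p k nk)).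
have /choice[z zP] : forall k, exists z, [/\ E z, P (deg k) z &
    forall s r, E0 s -> E r -> s * z = u * r -> M s].
  move=> k; rewrite /deg; case: ifP => _; first exact: minimal_multiple y0.
  apply: (@minimal_multiple _ (x ^+ k)); [exact: (satX satE) | exact: (homX gP) |].
  by rewrite expf_neq0.
have /choice[s /choice[c /choice[r scr]]] := fun k => local_span (let: And3 Ez _ _ := zP k in Ez).
have [|q [E0q [k0 nMq] Dq]] := @local_relation p c; first by move=> k; case: (scr k).
pose W := \sum_k q k * r k.
have EW : E W.
  by apply: (sat_sum satE) => k _; apply: (satM satE); [apply: E0_sub | case: (scr k)].
have Dsum : \sum_k q k * s k * z k = u * W.
  rewrite /W mulr_sumr.
  transitivity (\sum_k (\sum_(i < p) q k * c k i * t ^+ i + u * (q k * r k))).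
    apply: eq_bigr => k _; have [_ _ _ Dz] := scr k.
    rewrite -mulrA Dz mulrDr mulr_sumr mulrCA; congr (_ + _).
    by apply: eq_bigr => i _; rewrite mulrA.
  rewrite big_split exchange_big /= big1 ?add0r // => i _.
  by rewrite -mulr_suml Dq ?mul0r.
have [E0s nMs] : E0 (s k0) /\ ~ M (s k0) by case: (scr k0).
apply: (primeP primeM nMq nMs).
have [_ _ zmin] := zP k0.
apply: (zmin _ (component P (deg k0) W)); [exact: (satM sat_E0) | exact: E_component |].
rewrite -(component0M gP); last by case: E0u.
rewrite -Dsum.
have Pqsz k : true -> P (deg k) (q k * s k * z k).
  move=> _; apply: (hom0M gP); last by case: (zP k).
  by apply: (hom0M gP); [case: (E0q k) | case: (scr k) => -[[]]].
rewrite (component_sum_hom gP _ _ Pqsz) (eq_bigl (pred1 k0)) ?big_pred1_eq // => k.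
by rewrite /= (inj_eq deg_inj).
Qed.

End RankOneCore.

Section RankOne.

Variables (R : idomainType) (j : {rmorphism R -> algC}).
Hypotheses (j_inj : injective j) (j_int : forall x, j x \in Aint).
Hypothesis R_closed : integrally_closed R.

Lemma prime_above p : prime p -> exists2 M : set R, prime_ideal M & M p%:R.
Proof.
move=> pr_p; apply: prime_ideal_exists => r; apply/eqP => /(congr1 j).
rewrite rmorphM rmorph1 rmorph_nat => rp1.
have p0 : p%:R != 0 :> algC by rewrite pnatr_eq0 -lt0n prime_gt0.
have Dr : j r = p%:R^-1 by apply: (mulIf p0); rewrite rp1 mulVf.
have : j r \in Num.int.
  by apply: Cint_rat_Aint => //; rewrite Dr -(rmorph_nat (@ratr algC)) -fmorphV Crat_rat.
case/intrP => m Dm; move/eqP: rp1; rewrite Dm -[p%:R]/((p%:Z)%:~R) -rmorphM /=.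
rewrite -[X in _ == X]/(1%:~R) eqr_int => /eqP mp1.
have : (p %| 1)%Z by apply/dvdzP; exists m.
by rewrite dvdz1 => /eqP p1; rewrite /= in p1; rewrite p1 in pr_p.
Qed.

Section NumberField.

Variables (Qs : fieldExtType rat) (iota : {rmorphism Qs -> algC}).

(** The intersection of R with the number field Qs. *)
Definition field_part : set R := [set z | exists e, j z = iota e].

Lemma field_part_saturated : saturated_subring field_part.
Proof.
split.
- by exists 1; rewrite !rmorph1.
- by move=> x y [a Dx] [b Dy]; exists (a - b); rewrite !rmorphB Dx Dy.
- by move=> x y [a Dx] [b Dy]; exists (a * b); rewrite !rmorphM Dx Dy.
move=> x y w [a Dx] [b Dy] y0 Dw; exists (a / b).
have jy0 : j y != 0 by rewrite (j_eq0 j_inj).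
by apply: (mulIf jy0); rewrite -rmorphM Dw Dx Dy fmorph_div divfK // -Dy.
Qed.

(** The coefficients of a relation are divisible by all powers of p. *)
Lemma independent_mod_free (E : set R) p n (e : 'I_n -> R) (a : 'I_n -> int) :
    prime p -> E 0 -> independent_mod E p e ->
  \sum_i (a i)%:~R * e i = 0 -> forall i, a i = 0.
Proof.
move=> pr_p E0 ind_e; have p_gt0 := prime_gt0 pr_p.
have p0 : p%:R != 0 :> R by apply: (nat_neq0 j_inj).
suff dvd_pow m : forall a : 'I_n -> int, \sum_i (a i)%:~R * e i = 0 ->
    forall i, ((p ^ m)%N %| a i)%Z.
  move=> sum0 i; apply/eqP; rewrite -absz_eq0; apply/negPn/negP => ai0.
  have := dvd_pow `|a i|%N a sum0 i; rewrite dvdzE absz_nat => /dvdn_leq.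
  by rewrite lt0n => /(_ ai0); rewrite leqNgt ltn_expl ?prime_gt1.
elim: m => [|m IHm] {}a sum0 i; first by rewrite expn0 dvd1z.
have pa k : (p %| a k)%Z by apply: (ind_e a 0 E0); rewrite sum0 mulr0.
have Da k : a k = (a k %/ p)%Z * p by rewrite divzK.
rewrite Da expnSr PoszM dvdz_mul //; apply: (IHm (fun k => (a k %/ p)%Z)).
apply: (mulfI p0); rewrite mulr0 -[RHS]sum0 mulr_sumr; apply: eq_bigr => k _.
by rewrite [in RHS]Da intrM mulrA [p%:R * _]mulrC.
Qed.

Lemma field_part_finite_rank p : prime p -> exists d, forall n (e : 'I_n -> R),
  (forall i, field_part (e i)) -> independent_mod field_part p e -> (n <= d)%N.
Proof.
move=> pr_p; exists (\dim {:Qs}) => n e Ee ind_e; rewrite leqNgt; apply/negP => lt_dn.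
have [eps Deps] := choice Ee; pose X := [tuple eps i | i < n].
have /freeP nfree : ~~ free X.
  rewrite /free neq_ltn (leq_ltn_trans (dimvS (subvf _))) //.
  by rewrite size_tuple.
apply: nfree => k sum0 i; pose N := \prod_i denq (k i).
have N0 : N != 0 by apply/prodf_neq0 => l _; apply: denq_neq0.
have DkN l : exists a : int, a%:~R = k l * N%:~R.
  exists (numq (k l) * \prod_(m | m != l) denq (k m)).
  have -> : N = denq (k l) * \prod_(m | m != l) denq (k m) by rewrite /N (bigD1 l).
  rewrite !rmorphM /= mulrA; congr (_ * _).
  by rewrite -{2}[k l]divq_num_den divfK // intr_eq0 denq_neq0.
have [a Da] := choice DkN.
have E0 : field_part 0 := sat0 field_part_saturated.
have a0 : a i = 0.
  apply: (independent_mod_free pr_p E0 ind_e) => //; apply: j_inj.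
  transitivity (iota (N%:~R *: \sum_(l < n) k l *: X`_l)); last first.
    by rewrite sum0 scaler0 !rmorph0.
  rewrite scaler_sumr !rmorph_sum; apply: eq_bigr => l _.
  have -> : X`_l = eps l by rewrite -tnth_nth tnth_mktuple.
  rewrite scalerA [_ * k l]mulrC -Da scaler_int rmorphMz mulrzl rmorphMz /=.
  by rewrite Deps.
apply: (mulIf (_ : N%:~R != 0)); first by rewrite intr_eq0.
by rewrite mul0r -Da a0.
Qed.

Lemma field_part_cancel_int (n : int) z : n != 0 -> field_part (n%:~R * z) -> field_part z.
Proof.
move=> n0 [e De]; exists (e / n%:~R).
have nC0 : n%:~R != 0 :> algC by rewrite intr_eq0.
apply: (mulfI nC0); rewrite fmorph_div rmorph_int mulrCA divff // mulr1 -De.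
by rewrite rmorphM rmorph_int.
Qed.

Variables (G : zmodType) (P : G -> set R) (p : nat).
Hypothesis gP : is_grading P.

(** The integer factor n lets this hold on a whole field and not only on the ring
    generated by homogeneous elements of R. *)
Definition torsion_sum (e : Qs) : Prop := exists (n : int) (s : seq R),
  [/\ n != 0, n%:~R * iota e = j (\sum_(w <- s) w) &
      forall w, w \in s -> field_part w /\ exists2 g, g *+ p = 0 & P g w].

Lemma torsion_sumD a b : torsion_sum a -> torsion_sum b -> torsion_sum (a + b).
Proof.
move=> [n [s [n0 Da hs]]] [m [s' [m0 Db hs']]].
exists (n * m), ([seq m%:~R * w | w <- s] ++ [seq n%:~R * w | w <- s']); split.
- by rewrite mulf_neq0.
- rewrite big_cat !big_map -!mulr_sumr /= intrM (rmorphD iota) (rmorphD j) !(rmorphM j).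
  by rewrite -Da -Db !(rmorph_int j); ring.
have satE := field_part_saturated.
by move=> w; rewrite mem_cat => /orP[] /mapP[w'] => [/hs|/hs'] [Ew' [g pg Pw']] ->;
   split; [apply: (satM satE) => //; apply: (sat_int satE)
          | exists g => //; apply: (hom0M gP) => //; apply: hom_int
          | apply: (satM satE) => //; apply: (sat_int satE)
          | exists g => //; apply: (hom0M gP) => //; apply: hom_int].
Qed.

Lemma torsion_sumM a b : torsion_sum a -> torsion_sum b -> torsion_sum (a * b).
Proof.
move=> [n [s [n0 Da hs]]] [m [s' [m0 Db hs']]].
exists (n * m), [seq v * w | v <- s, w <- s']; split.
- by rewrite mulf_neq0.
- by rewrite big_allpairs_dep intrM (rmorphM iota) mulrACA Da Db -rmorphM big_distrlr.
have satE := field_part_saturated.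
move=> _ /allpairsP[[v w] /= [/hs[Ev [g pg Pv]] /hs'[Ew [h ph Pw]] ->]].
split; first exact: (satM satE).
by exists (g + h); [rewrite mulrnDl pg ph addr0 | apply: (homM gP)].
Qed.

Lemma torsion_sum_rat (a : rat) : torsion_sum a%:A.
Proof.
exists (denq a), [:: (numq a)%:~R]; split; first exact: denq_neq0.
  rewrite big_seq1 rmorph_int alg_num_field fmorph_rat -[(denq a)%:~R](rmorph_int (@ratr algC)).
  rewrite -rmorphM /= mulrC -{1}[a]divq_num_den divfK ?intr_eq0 ?denq_neq0 //.
  by rewrite rmorph_int.
move=> w; rewrite inE => /eqP->; split; first exact: (sat_int field_part_saturated).
by exists 0; [rewrite mul0rn | apply: hom_int].
Qed.

(** These elements form a ring, so adjoining one element to a field of them gives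
    no new elements. *)
Lemma torsion_sum_adjoin (V : {subfield Qs}) a :
  (forall e, e \in V -> torsion_sum e) -> torsion_sum a ->
  forall e, e \in <<V; a>>%VS -> torsion_sum e.
Proof.
move=> tV ta e /Fadjoin_polyP[q /polyOverP Vq ->]; rewrite horner_coef.
have torsion_sum_alg (b : rat) := torsion_sum_rat b.
elim/big_ind: _ => [||i _]; [by rewrite -(scale0r 1) | exact: torsion_sumD |].
apply: torsion_sumM; first exact: tV.
elim: (i : nat) => [|k IHk]; first by rewrite expr0 -[1]scale1r.
by rewrite exprS; apply: torsion_sumM.
Qed.

Hypothesis all_torsion : forall e, torsion_sum e.

Lemma field_part_component z g :
  field_part z -> field_part (component P g z) /\
    (component P g z != 0 -> g *+ p = 0).
Proof.
move=> [e De]; have [n [s [n0 Ds hs]]] := all_torsion e.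
have Dz : n%:~R * z = \sum_(w <- s) w by apply: j_inj; rewrite rmorphM rmorph_int De.
have Dc : n%:~R * component P g z = \sum_(w <- s) component P g w.
  by rewrite -(component0M gP) ?Dz ?component_sum //; apply: hom_int.
have satE := field_part_saturated; split.
  apply: (field_part_cancel_int n0); rewrite Dc big_seq.
  apply: (sat_sum satE) => w /hs[Ew [h _ Pw]].
  by rewrite (component_hom gP _ Pw); case: ifP => _ //; apply: (sat0 satE).
move=> c0; apply: contrapT => npg; case/eqP: c0.
have nR0 : n%:~R != 0 :> R by rewrite -(j_eq0 j_inj) rmorph_int intr_eq0.
apply: (mulfI nR0); rewrite Dc mulr0 big_seq big1 // => w /hs[_ [h ph Pw]].
by rewrite (component_hom gP _ Pw); case: eqP => // hg; rewrite -hg ph in npg.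
Qed.

End NumberField.

(** [rank_one_core] applies to the intersection of R with the field Q(x, y), which
    is generated by homogeneous elements of degrees killed by p. *)
Theorem grading_rank_le1 (G : zmodType) (P : G -> set R) p g h x y :
    is_grading P -> prime p -> P g x -> P h y -> x != 0 -> y != 0 ->
  g != 0 -> g *+ p = 0 -> h *+ p = 0 -> exists i, h = g *+ i.
Proof.
move=> gP pr_p Px Py x0 y0 g0 pg ph; apply: contrapT => no_i.
have [Qs [iota [s1 Ds1 gen]]] := num_field_exists [:: j x; j y].
case: s1 Ds1 gen => [|x1 [|y1 []]] // [Dx1 Dy1] gen.
pose E := field_part iota.
have Ex : E x by exists x1.
have Ey : E y by exists y1.
have tors_hom e w k : k *+ p = 0 -> P k w -> iota e = j w -> torsion_sum iota P p e.
  move=> pk Pw De; exists 1, [:: w]; split=> //; first by rewrite big_seq1 mul1r.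
  by move=> v; rewrite inE => /eqP->; split; [exists e | exists k].
have all_tors e : torsion_sum iota P p e.
  have : e \in <<<<1; x1>>; y1>>%VS.
    by have := memvf e; rewrite -gen adjoin_cons adjoin_cons Fadjoin_nil.
  apply: torsion_sum_adjoin => //; last exact: (tors_hom y1 y h).
  apply: torsion_sum_adjoin => //; last exact: (tors_hom x1 x g).
  by move=> a /vlineP[b ->]; apply: torsion_sum_rat.
have [M primeM Mp] := prime_above pr_p.
have satE : saturated_subring E := field_part_saturated iota.
have rankE := @field_part_finite_rank _ iota p pr_p.
have Ecomp z k : E z -> E (component P k z).
  by move=> Ez; case: (field_part_component gP all_tors k Ez).
have Etors z k : E z -> component P k z != 0 -> k *+ p = 0.
  by move=> Ez; case: (field_part_component gP all_tors k Ez).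
have [t [Et Mt tmin]] := uniformizer_exists j_inj R_closed satE primeM pr_p Mp rankE.
have satE0 := sat_E0 gP satE.
have rankE0 := finite_rank_E0 j_inj gP pr_p rankE.
have [u [Eu Mu umin]] := uniformizer_exists j_inj R_closed satE0 primeM pr_p Mp rankE0.
apply: (rank_one_core j_inj j_int R_closed gP satE primeM pr_p Mp Ecomp Etors
  Et Mt Eu Mu tmin umin Ex Ey Px Py x0 y0 g0).
by move=> i Dh; apply: no_i; exists i.
Qed.

End RankOne.

Local Close Scope classical_set_scope.

(** * The universal grading of an integrally closed ring *)

Theorem theorem1p8 (S : subringClosed algC) (S_int : {subset S <= Aint})
    (S_ic : integrally_closed (subring S)) :
  exists (G : zmodType) (P : G -> set (subring S)),
    is_universal_grading P /\ isomorphic_to_subgroup G QmodZ.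
Proof.
pose j : {rmorphism subring S -> algC} := val.
have j_inj : injective j := val_inj.
have j_int x : j x \in Aint by apply/S_int/subring_valP.
have univ := universal_family_universal j_inj j_int.
have gP := universal_family_grading j_inj j_int.
exists (universal_group j_inj j_int), (@universal_family _ j j_inj j_int).
split=> //; apply: embedding_QmodZ => [a | p c e pr_p c0 pc pe].
  exists (torsion_exponent j (val (repr (a : degree_class _)))).
    exact: torsion_exponent_gt0.
  by apply: (degree_torsion j_inj j_int gP (hom_elt_neq0 _));
    apply: universal_family_repr.
apply: (grading_rank_le1 j_inj j_int S_ic gP pr_p
  (@universal_family_repr _ _ j_inj j_int c) (@universal_family_repr _ _ j_inj j_int e)) => //;
  exact: hom_elt_neq0.
Qed.
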